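(* Let $\Phi(t)$ be a continuous (real $2n\times 2n$) symplectic matrix function on $[a,b]$ and let $$\mathcal F(\Phi):=\{\Phi(\cdot)C:\ C\in\mathbb R^{2n\times n}\text{ is a Lagrangian plane}\}.$$ For any continuous Lagrangian paths $Y,\hat Y\in\mathcal F(\Phi)$ we have $$\mathcal N(Y,[a,b])-\mathcal N(\hat Y,[a,b])=\mu(Y(b),\hat Y(b))-\mu(Y(a),\hat Y(a)),$$ $$\mathcal N^*(Y,[a,b])-\mathcal N^*(\hat Y,[a,b])=\mu^*(Y(a),\hat Y(a))-\mu^*(Y(b),\hat Y(b)).$$
   Context: Notation. $n\in\mathbb N$, $[a,b]\subseteq\mathbb R$, $\mathcal J=\begin{pmatrix}0&I\\ -I&0\end{pmatrix}\in\mathbb R^{2n\times2n}$, $E=\begin{pmatrix}0\\ I\end{pmatrix}\in\mathbb R^{2n\times n}$. A real $2n\times 2n$ matrix $S$ is symplectic if $S^T\mathcal JS=\mathcal J$. A Lagrangian plane is a constant $Y\in\mathbb R^{2n\times n}$ with $Y^T\mathcal JY=0$ and $\operatorname{rank}Y=n$. A continuous Lagrangian path on $[a,b]$ is a continuous $Y:[a,b]\to\mathbb R^{2n\times n}$ such that every $Y(t)$ is a Lagrangian plane. We write $Y=\begin{pmatrix}X\\ U\end{pmatrix}$ with $n\times n$ blocks (similarly $\hat Y$ with $\hat X,\hat U$). The Wronskian is $W(Y,\hat Y)=Y^T\mathcal J\hat Y$. Comparative index. For Lagrangian planes $Y,\hat Y$ put $\mathcal M=(I-X^\dagger X)W(Y,\hat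 Y)$, $V=I-\mathcal M^\dagger\mathcal M$, $\mathcal P=V[W(Y,\hat Y)]^TX^\dagger\hat XV$ (a symmetric matrix), where $\dagger$ is the Moore–Penrose pseudoinverse. The comparative index and dual comparative index are $\mu(Y,\hat Y)=\operatorname{rank}\mathcal M+\operatorname{ind}\mathcal P$, $\mu^*(Y,\hat Y)=\operatorname{rank}\mathcal M+\operatorname{ind}(-\mathcal P)$, with $\operatorname{ind}$ the number of negative eigenvalues. Oscillation numbers. For a continuous Lagrangian path $Y$ on $[a,b]$ take a partition $a=t_0<t_1<\dots<t_p=b$ and real symplectic matrix functions $R_k(t)$, $k=0,\dots,p-1$, with $R_k$ continuous on $[t_k,t_{k+1}]$ and such that, for each $k$, both $\operatorname{rank}W(R_k(t)E,Y(t))$ and $\operatorname{rank}\big((I\ \,0)R_k(t)E\big)$ are constant for $t\in[t_k,t_{k+1}]$. Then $$\mathcal N(Y,[a,b]):=\sum_{k=0}^{p-1}\big[\mu(Y(t_{k+1}),R_k(t_{k+1})E)-\mu(Y(t_k),R_k(t_k)E)\big],$$ $$\mathcal N^*(Y,[a,b]):=\sum_{k=0}^{p-1}\big[\mu^*(Y(t_k),R_k(t_k)E)-\mu^*(Y(t_{k+1}),R_k(t_{k+1})E)\big].$$ Such partitions and systems exist and the values do not depend on their choice. *)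

(* Defs.v *)
From HB Require Import structures.
From mathcomp Require Import all_boot all_order all_algebra.
From mathcomp Require Import polyrcf.
From mathcomp Require Import all_classical all_reals all_analysis.
Set Implicit Arguments.
Unset Strict Implicit.
Unset Printing Implicit Defensive.
Import Order.TTheory GRing.Theory Num.Theory.
Import numFieldNormedType.Exports.
Local Open Scope classical_set_scope.
Local Open Scope ring_scope.

(* The four Penrose equations, over the reals. *)
Definition is_mpinv (R : realType) (m n : nat)
    (A : 'M[R]_(m, n)) (X : 'M[R]_(n, m)) : Prop :=
  [/\ A *m X *m A = A, X *m A *m X = X,
      (A *m X)^T = A *m X & (X *m A)^T = X *m A].

(* The default value 0 is never used: see [mpinvP] and [is_mpinv_uniq]. *)
Definition mpinv (R : realType) (m n : nat) (A : 'M[R]_(m, n)) :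
  'M[R]_(n, m) := xget 0 [set X | is_mpinv A X].

Lemma is_mpinv_uniq (R : realType) (m n : nat) (A : 'M[R]_(m, n))
    (X Y : 'M[R]_(n, m)) : is_mpinv A X -> is_mpinv A Y -> X = Y.
Proof.
move=> [X1 X2 X3 X4] [Y1 Y2 Y3 Y4].
have AXY : A *m X = A *m Y.
  have -> : A *m X = (A *m Y *m (A *m X))^T by rewrite mulmxA Y1 X3.
  by rewrite trmx_mul X3 Y3 mulmxA X1.
have XYA : X *m A = Y *m A.
  have -> : X *m A = (X *m A *m (Y *m A))^T.
    by rewrite -mulmxA (mulmxA A) Y1 X4.
  by rewrite trmx_mul X4 Y4 -mulmxA (mulmxA A) X1.
by rewrite -X2 XYA -mulmxA AXY mulmxA Y2.
Qed.

Lemma gram_unitmx (R : realType) (r k : nat) (B : 'M[R]_(r, k)) :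
  row_free B -> B *m B^T \in unitmx.
Proof.
move=> freeB; rewrite -row_free_unit -kermx_eq0; apply/rowV0P => v.
move=> /sub_kermxP; rewrite mulmxA => vBB.
have vB0 : v *m B = 0.
  have : (v *m B) *m (v *m B)^T = 0 by rewrite trmx_mul mulmxA vBB mul0mx.
  move=> /matrixP /(_ 0 0); rewrite !mxE => s0.
  have {}s0 : \sum_j (v *m B) 0 j ^+ 2 = 0.
    by rewrite -[RHS]s0; apply: eq_bigr => j _; rewrite [_^T _ _]mxE expr2.
  apply/rowP => j; rewrite [RHS]mxE; apply/eqP; rewrite -sqrf_eq0; apply/eqP.
  apply: (psumr_eq0P (P := xpredT) (F := fun j => (v *m B) 0 j ^+ 2)) => //.
  by move=> i _; exact: sqr_ge0.
by apply: (row_free_inj freeB); rewrite vB0 mul0mx.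
Qed.

Lemma mpinvP (R : realType) (m n : nat) (A : 'M[R]_(m, n)) :
  is_mpinv A (mpinv A).
Proof.
rewrite -[is_mpinv A _]/([set X | is_mpinv A X] _); apply: xgetPex.
suff H (r : nat) (C : 'M[R]_(m, r)) (F : 'M[R]_(r, n)) :
    row_full C -> row_free F -> exists X, is_mpinv (C *m F) X.
  by rewrite -[A]mulmx_base; apply: H;
    [exact: col_base_full | exact: row_base_free].
move=> fullC freeF.
have uF : F *m F^T \in unitmx by exact: gram_unitmx.
have uC : C^T *m C \in unitmx.
  by rewrite -{2}[C]trmxK; apply: gram_unitmx; rewrite /row_free mxrank_tr.
set GF := F *m F^T in uF; set GC := C^T *m C in uC.
have tGF : GF^T = GF by rewrite /GF trmx_mul trmxK.
have tGC : GC^T = GC by rewrite /GC trmx_mul trmxK.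
exists (F^T *m invmx GF *m invmx GC *m C^T).
set X := _ *m C^T.
have AX : C *m F *m X = C *m invmx GC *m C^T.
  by rewrite /X !mulmxA -(mulmxA C) -/GF -(mulmxA C GF) mulmxV // mulmx1.
have XA : X *m (C *m F) = F^T *m invmx GF *m F.
  by rewrite /X !mulmxA -(mulmxA _ C^T) -/GC -(mulmxA _ _ GC) mulVmx // mulmx1.
split.
- by rewrite AX !mulmxA -(mulmxA _ C^T) -/GC -(mulmxA _ _ GC) mulVmx // mulmx1.
- by rewrite XA /X !mulmxA -(mulmxA _ F) -/GF -(mulmxA _ _ GF) mulVmx // mulmx1.
- by rewrite AX !trmx_mul trmxK trmx_inv tGC mulmxA.
- by rewrite XA !trmx_mul trmxK trmx_inv tGF mulmxA.
Qed.

(* Negative eigenvalues are counted with their (algebraic) multiplicity. *)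
Definition ind (R : realType) (n : nat) (A : 'M[R]_n) : nat :=
  (\sum_(x <- rootsR (char_poly A) | (x < 0)%R) mup x (char_poly A))%N.

Definition Jmx (R : realType) (n : nat) : 'M[R]_(n + n) :=
  block_mx 0 1%:M (- 1%:M) 0.

Definition Emx (R : realType) (n : nat) : 'M[R]_(n + n, n) :=
  col_mx 0 1%:M.

Definition symplectic (R : realType) (n : nat) (S : 'M[R]_(n + n)) : Prop :=
  S^T *m Jmx R n *m S = Jmx R n.

Definition wronskian (R : realType) (n : nat) (Y Yh : 'M[R]_(n + n, n)) :
  'M[R]_n := Y^T *m Jmx R n *m Yh.

Definition lagrangian (R : realType) (n : nat) (Y : 'M[R]_(n + n, n)) : Prop :=
  Y^T *m Jmx R n *m Y = 0 /\ \rank Y = n.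

Definition lagrangian_path (R : realType) (n : nat) (a b : R)
    (Y : R -> 'M[R]_(n + n, n)) : Prop :=
  {within `[a, b], continuous Y} /\ forall t, t \in `[a, b] -> lagrangian (Y t).

(* In the block decomposition Y = (X; U), the block X is [usubmx Y]. *)
Definition ci_M (R : realType) (n : nat) (Y Yh : 'M[R]_(n + n, n)) : 'M[R]_n :=
  (1%:M - mpinv (usubmx Y) *m usubmx Y) *m wronskian Y Yh.

Definition ci_V (R : realType) (n : nat) (Y Yh : 'M[R]_(n + n, n)) : 'M[R]_n :=
  1%:M - mpinv (ci_M Y Yh) *m ci_M Y Yh.

Definition ci_P (R : realType) (n : nat) (Y Yh : 'M[R]_(n + n, n)) : 'M[R]_n :=
  ci_V Y Yh *m (wronskian Y Yh)^T *m mpinv (usubmx Y) *m usubmx Yh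
    *m ci_V Y Yh.

Definition mu (R : realType) (n : nat) (Y Yh : 'M[R]_(n + n, n)) : nat :=
  (\rank (ci_M Y Yh) + ind (ci_P Y Yh))%N.

Definition mu_dual (R : realType) (n : nat) (Y Yh : 'M[R]_(n + n, n)) : nat :=
  (\rank (ci_M Y Yh) + ind (- ci_P Y Yh))%N.

(* Only t_0, ..., t_p and Q_0, ..., Q_(p-1) matter, each Q_k only on
   [t_k, t_(k+1)]; p = 0 is possible only if a = b. *)
Definition admissible (R : realType) (n : nat) (Y : R -> 'M[R]_(n + n, n))
    (a b : R) (p : nat) (t : nat -> R) (Q : nat -> R -> 'M[R]_(n + n)) : Prop :=
  [/\ t 0%N = a, t p = b, forall k, (k < p)%N -> t k < t k.+1 &
   forall k, (k < p)%N ->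
    [/\ {within `[t k, t k.+1], continuous (Q k)},
        forall s, s \in `[t k, t k.+1] -> symplectic (Q k s),
        exists r : nat, forall s, s \in `[t k, t k.+1] ->
          \rank (wronskian (Q k s *m Emx R n) (Y s)) = r &
        exists r : nat, forall s, s \in `[t k, t k.+1] ->
          \rank (row_mx 1%:M 0 *m Q k s *m Emx R n : 'M[R]_n) = r]].

Definition osc_sum (R : realType) (n : nat) (Y : R -> 'M[R]_(n + n, n))
    (p : nat) (t : nat -> R) (Q : nat -> R -> 'M[R]_(n + n)) : int :=
  \sum_(k < p) ((mu (Y (t k.+1)) (Q k (t k.+1) *m Emx R n))%:Z
                - (mu (Y (t k)) (Q k (t k) *m Emx R n))%:Z).

Definition osc_sum_dual (R : realType) (n : nat) (Y : R -> 'M[R]_(n + n, n))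
    (p : nat) (t : nat -> R) (Q : nat -> R -> 'M[R]_(n + n)) : int :=
  \sum_(k < p) ((mu_dual (Y (t k)) (Q k (t k) *m Emx R n))%:Z
                - (mu_dual (Y (t k.+1)) (Q k (t k.+1) *m Emx R n))%:Z).

(* For a continuous Lagrangian path, admissible data exist and all of them give
   the same sum, so [xget] returns that common value and never the default. *)
Definition osc (R : realType) (n : nat) (Y : R -> 'M[R]_(n + n, n))
    (a b : R) : int :=
  xget 0 [set N | exists p t Q,
                    admissible Y a b p t Q /\ N = osc_sum Y p t Q].

Definition osc_dual (R : realType) (n : nat) (Y : R -> 'M[R]_(n + n, n))
    (a b : R) : int :=
  xget 0 [set N | exists p t Q,
                    admissible Y a b p t Q /\ N = osc_sum_dual Y p t Q].

(* Paths are total functions on R, of which only the restriction to [a, b]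
   is meaningful. *)
Definition Lfamily (R : realType) (n : nat) (a b : R)
    (Phi : R -> 'M[R]_(n + n)) : set (R -> 'M[R]_(n + n, n)) :=
  [set Y | exists C : 'M[R]_(n + n, n),
     lagrangian C /\ forall t, t \in `[a, b] -> Y t = Phi t *m C].

(* Main.v *)
(* Fix a real q such that the plane G = (1; q) is transversal to the Lagrangian
   planes at hand; this excludes finitely many q only. A plane Y transversal to
   G is described by a symmetric matrix S(Y), depending continuously on Y, and
   Haynsworth's inertia formula, applied to [[S(Y), S(Z)], [S(Z), S(Z)]], turns
   the definition of the comparative index into
     mu(Y, Z) - mu(Y, G) + mu(Z, G) = ind (S(Y) - S(Z)),
     mu(Y, G) = n - ind S(Y).
   The rank of S(Y) - S(Z) is that of the Wronskian and the rank of S(Y) is that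
   of X; the index is locally constant along continuous symmetric matrices of
   constant rank. Hence, for any admissible data, t |-> mu(Y(t), R_k(t)E) and
   t |-> mu(Y(t), G) have locally the same increments, and N(Y) is the increment
   of any function f such that f - mu(Y, G) is locally constant. If f is such a
   function for Y, then f - mu(Y, Yh) is one for Yh because the rank of
   W(Y, Yh) is constant. The dual identity is the first one for the paths
   diag(1, -1)Y and diag(1, -1)Yh. *)

Require Import Defs.
From HB Require Import structures.
From mathcomp Require Import all_boot all_order all_algebra.
From mathcomp Require Import polyrcf complex spectral.
From mathcomp Require Import all_classical all_reals all_analysis.
From mathcomp Require Import ring lra zify.
Set Implicit Arguments.
Unset Strict Implicit.
Unset Printing Implicit Defensive.
Import Order.TTheory GRing.Theory Num.Theory.
Import numFieldNormedType.Exports.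
Local Open Scope classical_set_scope.
Local Open Scope ring_scope.

(** * Spectral theorem and the index of a diagonalized matrix *)

(** The complexification of [A] is Hermitian, hence has real spectrum; an eigenvalue over the closed
    field [R[i]] is therefore a real root of the characteristic polynomial of [A]. *)
Lemma sym_eigenvalue (R : realType) (n : nat) (A : 'M[R]_n) :
  (0 < n)%N -> A^T = A -> exists a, eigenvalue A a.
Proof.
move=> n_gt0 symA.
have hermA : map_mx (real_complex R) A \is hermsymmx.
  apply: realsym_hermsym.
    by apply/is_hermitianmxP; rewrite expr0 scale1r map_mx_id // map_trmx symA.
  by apply/mxOverP => i j; rewrite mxE; apply/complex_realP; exists (A i j).
have [c /eigenvalueP[v vA v0]] := eigenvalue_closed (map_mx (real_complex R) A)
  n_gt0.
have /complex_realP [a ca] : c \is Num.real.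
  have unitP := spectral_unit (map_mx (real_complex R) A).
  have := hermitian_spectral_diag_real hermA.
  have /hermitian_normalmx/orthomx_spectralP := hermA.
  set P := spectralmx _ in unitP *; set d := spectral_diag _ => AE /mxOverP dR.
  have uE : v *m invmx P *m diag_mx d = c *: (v *m invmx P).
    by rewrite scalemxAl -vA [in RHS]AE !mulmxA mulmxK.
  have /rV0Pn [j uj] : v *m invmx P != 0.
    by apply: contraNneq v0 => vP; rewrite -[v](mulmxKV unitP) vP mul0mx.
  move: (v *m invmx P) uE uj => u /rowP/(_ j) + uj.
  rewrite mul_mx_diag !mxE mulrC => /(mulIf uj) <-.
  exact: dR.
exists a; rewrite eigenvalue_root_char -(fmorph_root (real_complex R)).
rewrite map_char_poly -eigenvalue_root_char; apply/eigenvalueP.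
by exists v; rewrite // vA ca.
Qed.

Lemma mulmx_trE (R : realType) (n : nat) (v : 'rV[R]_n) :
  v *m v^T = (\sum_j v 0 j ^+ 2)%:M.
Proof.
apply/matrixP => i j; rewrite !ord1 !mxE eqxx mulr1n.
by apply: eq_bigr => k _; rewrite mxE expr2.
Qed.

Lemma sumsq_eq0 (R : realType) (n : nat) (v : 'rV[R]_n) :
  (\sum_j v 0 j ^+ 2 == 0) = (v == 0).
Proof.
apply/idP/idP => [|/eqP->]; last first.
  by rewrite big1 // => j _; rewrite mxE expr0n.
rewrite psumr_eq0 => [/allP v0|j _]; last exact: sqr_ge0.
apply/eqP/rowP => j; rewrite mxE; apply/eqP; rewrite -sqrf_eq0.
by apply: v0; rewrite mem_index_enum.
Qed.

Lemma sumsq_ge0 (R : realType) (n : nat) (v : 'rV[R]_n) :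
  0 <= \sum_j v 0 j ^+ 2.
Proof. by apply: sumr_ge0 => j _; exact: sqr_ge0. Qed.

(* The Householder reflection exchanging the unit vectors u and v. *)
Lemma orthogonal_between (R : realType) (n : nat) (u v : 'rV[R]_n) :
  u *m u^T = 1%:M -> v *m v^T = 1%:M ->
  exists P : 'M[R]_n, P *m P^T = 1%:M /\ u *m P = v.
Proof.
move=> uu vv; have [<-|neq_uv] := eqVneq u v.
  by exists 1%:M; rewrite trmx1 !mulmx1.
pose w := u - v; pose s := \sum_j w 0 j ^+ 2.
have s0 : s != 0 by rewrite /s sumsq_eq0 subr_eq0.
have ww : w *m w^T = s%:M by rewrite mulmx_trE.
pose P := 1%:M - (2 / s) *: (w^T *m w).
have symP : P^T = P by rewrite /P linearB /= trmx1 linearZ /= trmx_mul trmxK.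
exists P; split.
  have : w^T *m w *m (w^T *m w) = s *: (w^T *m w).
    by rewrite mulmxA -(mulmxA w^T) ww mul_mx_scalar scalemxAl.
  rewrite symP /P; move: (w^T *m w) => H HH.
  rewrite mulmxBl mul1mx mulmxBr mulmx1 -!scalemxAl -!scalemxAr HH !scalerA.
  by apply/matrixP => i j; rewrite !mxE; field.
have uw : u *m w^T = (s / 2)%:M.
  have uv1 : v *m u^T = u *m v^T.
    by rewrite -[LHS]trmxK trmx_mul trmxK [u *m v^T]mx11_scalar tr_scalar_mx.
  have : w *m w^T = 2 *: (u *m w^T).
    rewrite /w mulmxBl linearB /= !mulmxBr uv1 vv uu scaler_nat mulr2n.
    by rewrite opprB.
  rewrite ww => /(congr1 (fun M => 2^-1 *: M)).
  by rewrite scalerA mulVf ?scale1r ?pnatr_eq0 // scale_scalar_mx mulrC.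
rewrite /P mulmxBr mulmx1 -scalemxAr mulmxA uw mul_scalar_mx scalerA.
by rewrite [X in X *: _](_ : _ = 1) ?scale1r ?subKr //; field.
Qed.

Theorem sym_spectral (R : realType) (n : nat) (A : 'M[R]_n) : A^T = A ->
  exists (P : 'M[R]_n) (d : 'rV[R]_n),
    P *m P^T = 1%:M /\ A = P^T *m diag_mx d *m P.
Proof.
elim: n A => [|n IHn] A symA.
  by exists 1%:M, 0; split; apply/matrixP => -[].
rewrite -[n.+1]/(1 + n)%N in A symA *.
have [a eigA] := sym_eigenvalue (ltn0Sn n) symA.
have /eigenvalueP[x xA x0] := eigA.
have [v vA vv] : exists2 v : 'rV_(1 + n), v *m A = a *: v & v *m v^T = 1%:M.
  have s_ge0 := sumsq_ge0 x; set s := \sum_j _ in s_ge0.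
  have s0 : s != 0 by rewrite /s sumsq_eq0.
  exists ((Num.sqrt s)^-1 *: x).
    by rewrite -scalemxAl xA !scalerA mulrC.
  rewrite -scalemxAl linearZ /= -scalemxAr mulmx_trE scalerA -/s.
  by rewrite -invfM -expr2 sqr_sqrtr // scale_scalar_mx mulVf.
pose e := row_mx 1%:M 0 : 'rV[R]_(1 + n).
have ee : e *m e^T = 1%:M.
  by rewrite /e tr_row_mx mul_row_col trmx1 mulmx1 mul0mx addr0.
have [P [PP eP]] := orthogonal_between ee vv.
(* In an orthonormal basis starting with [v] the first row of the matrix is [a *: e]; symmetry
   clears the first column, and the induction applies to the remaining block. *)
pose B : 'M[R]_(1 + n) := P *m A *m P^T.
have symB : B^T = B by rewrite /B !trmx_mul trmxK symA mulmxA.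
have eB : e *m B = a *: e.
  by rewrite /B !mulmxA eP vA -scalemxAl -eP -mulmxA PP mulmx1.
have [ul ur] : ulsubmx B = a%:M /\ ursubmx B = 0.
  move: eB; rewrite -{1}[B]submxK /e mul_row_block !mul1mx !mul0mx !addr0.
  rewrite scale_row_mx scaler0 => /eq_row_mx [-> ->].
  by rewrite scale_scalar_mx mulr1.
have dl : dlsubmx B = 0.
  by rewrite -symB -trmx_ursub ur trmx0.
have [|Q [d [QQ BE]]] := IHn (drsubmx B); first by rewrite trmx_drsub symB.
pose Q' : 'M[R]_(1 + n) := block_mx 1%:M 0 0 Q.
exists (Q' *m P), (row_mx a%:M d); split.
  rewrite trmx_mul mulmxA -(mulmxA Q') PP mulmx1 /Q' tr_block_mx mulmx_block.
  rewrite !trmx0 trmx1 !mulmx0 !mul0mx !mulmx1 !addr0 !add0r QQ.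
  by rewrite -scalar_mx_block.
rewrite trmx_mul diag_mx_row !mulmxA.
have -> : A = P^T *m B *m P.
  by rewrite /B !mulmxA (mulmx1C PP) mul1mx -mulmxA (mulmx1C PP) mulmx1.
congr (_ *m _); rewrite -!mulmxA; congr (_ *m _).
rewrite -[LHS]submxK ul ur dl BE /Q' tr_block_mx !mulmx_block.
rewrite !trmx0 trmx1 !(mulmx0, mul0mx, mul1mx, mulmx1, addr0, add0r) ?mulmxA.
congr (block_mx _ _ _ _).
by apply/matrixP => i j; rewrite !ord1 !mxE eqxx.
Qed.

Lemma ind_diag (R : realType) (n : nat) (P : 'M[R]_n) (d : 'rV[R]_n) :
  P *m P^T = 1%:M -> ind (P^T *m diag_mx d *m P) = #|[pred i | d 0 i < 0]|.
Proof.
move=> PP; set A := _ *m P.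
have PtP := mulmx1C PP.
have chA : char_poly A = \prod_(x <- [seq d 0 i | i : 'I_n]) ('X - x%:P).
  transitivity (char_poly (diag_mx d)); last first.
    rewrite char_poly_trig ?diag_mx_is_trig // big_image /=.
    by apply: eq_bigr => i _; rewrite mxE eqxx mulr1n.
  have PPp : (map_mx polyC P)^T *m map_mx polyC P = 1%:M.
    by rewrite map_trmx -map_mxM PtP map_mx1.
  rewrite /char_poly /char_poly_mx.
  have -> : 'X%:M - map_mx polyC A = (map_mx polyC P)^T *m
      ('X%:M - map_mx polyC (diag_mx d)) *m map_mx polyC P.
    rewrite mulmxBr mulmxBl mul_mx_scalar -scalemxAl PPp scalemx1.
    by rewrite /A !map_mxM map_trmx.
  by rewrite !det_mulmx mulrAC -det_mulmx PPp det1 mul1r.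
rewrite /ind chA; set p := \prod_(_ <- _) _; set s := [seq _ | _ : _] in p *.
have p0 : p != 0 by rewrite /p monic_neq0 // monic_prod_XsubC.
have rs x : (x \in rootsR p) = (x \in s).
  by rewrite -(roots_on_rootsR p0) in_itv /= /p root_prod_XsubC.
have us : uniq (rootsR p) by exact: uniq_roots.
transitivity (count (fun x => x < 0) s).
  under eq_bigr do rewrite mu_prod_XsubC -sum1_count big_mkcond /=.
  rewrite exchange_big -sum1_count [RHS]big_mkcond /= !big_seq.
  apply: eq_bigr => y sy; rewrite -big_filter -big_mkcond /=.
  rewrite sum1_count /= (eq_count (a2 := pred1 y)); last first.
    by move=> x /=; rewrite eq_sym.
  rewrite count_uniq_mem ?filter_uniq // mem_filter rs sy andbT.
  by case: (y < 0).
by rewrite -sum1_count big_mkcond big_image /= -big_mkcond -[RHS]sum1_card.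
Qed.

(** * Sylvester's law of inertia *)

Lemma rank_diag (F : fieldType) (n : nat) (d : 'rV[F]_n) :
  \rank (diag_mx d) = (\sum_i (d 0%R i != 0%R))%N.
Proof.
elim: n d => [|n IHn] d; first by rewrite big_ord0 [diag_mx d]thinmx0 mxrank0.
rewrite -[n.+1]/(1 + n)%N in d *.
rewrite -[d]hsubmxK diag_mx_row rank_diag_block_mx IHn big_split_ord /=
  big_ord1.
congr (_ + _)%N; last by apply: eq_bigr => i _; rewrite row_mxEr.
rewrite row_mxEl; have [l0|l0] := eqVneq (lsubmx d 0 0) 0.
  rewrite [diag_mx _](_ : _ = 0) ?mxrank0 //.
  by apply/matrixP => i j; rewrite !ord1 !mxE -[RHS]l0 !mxE.
apply: mxrank_unit; rewrite unitmxE det_diag big_ord1 unitfE //.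
Qed.

Lemma diag_form (R : realType) (n : nat) (d y : 'rV[R]_n) :
  (y *m diag_mx d *m y^T) 0 0 = \sum_j d 0 j * y 0 j ^+ 2.
Proof.
rewrite mul_mx_diag mxE; apply: eq_bigr => j _; rewrite !mxE.
by rewrite mulrAC mulrC -expr2.
Qed.

(** If fewer than [k] entries of [d] were negative, some nonzero combination of the rows of [V]
    would have no component along the negative eigenvectors, and the form would be nonnegative on
    it. *)
Lemma ind_lower (R : realType) (n k : nat) (A : 'M[R]_n) (V : 'M[R]_(k, n)) :
  A^T = A ->
  (forall x : 'rV_k, x != 0 -> (x *m (V *m A *m V^T) *m x^T) 0 0 < 0) ->
  (k <= ind A)%N.
Proof.
move=> /sym_spectral[P [d [PP ->]]] negV; rewrite ind_diag //.
rewrite leqNgt; apply/negP => lt_k.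
pose m : 'rV[R]_n := \row_j (d 0 j < 0)%R%:R.
have : ~~ row_free (V *m P^T *m diag_mx m).
  rewrite /row_free neq_ltn (leq_ltn_trans (mxrankM_maxr _ _)) //.
  rewrite rank_diag (leq_ltn_trans _ lt_k) // -sum1_card [leqRHS]big_mkcond /=.
  by apply: leq_sum => j _; rewrite mxE inE; case: (_ < _)%R; rewrite ?eqxx
    ?oner_eq0.
rewrite -kermx_eq0 => /rowV0Pn[x /sub_kermxP xV0 x0].
have := negV x x0; rewrite ltNge; case/negP.
have -> : x *m (V *m (P^T *m diag_mx d *m P) *m V^T) *m x^T =
    (x *m V *m P^T) *m diag_mx d *m (x *m V *m P^T)^T.
  by rewrite !trmx_mul trmxK !mulmxA.
move: xV0; rewrite !mulmxA => xV0; rewrite diag_form sumr_ge0 // => j _.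
have [d_ge0|d_lt0] := lerP 0 (d 0 j); first by rewrite mulr_ge0 // sqr_ge0.
move/rowP: xV0 => /(_ j); rewrite mul_mx_diag mxE [m 0 j]mxE d_lt0 mulr1 => ->.
by rewrite mxE expr0n mulr0.
Qed.

Lemma ind_lowerN1 (R : realType) (n k : nat) (A : 'M[R]_n) (V : 'M[R]_(k, n)) :
  A^T = A -> V *m A *m V^T = - 1%:M -> (k <= ind A)%N.
Proof.
move=> symA VA; apply: (@ind_lower _ _ _ _ V) => // x x0.
rewrite VA mulmxN mulmx1 mulNmx mulmx_trE !mxE eqxx mulr1n oppr_lt0.
by rewrite lt_neqAle sumsq_ge0 eq_sym sumsq_eq0 x0.
Qed.

(* The factorization [V = Z *m A] places the negative definite subspace
   spanned by [V] inside the image of [A]. *)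
Lemma ind_certificate (R : realType) (n : nat) (A : 'M[R]_n) : A^T = A ->
  exists V Z : 'M[R]_(ind A, n), V *m A *m V^T = - 1%:M /\ V = Z *m A.
Proof.
move=> /sym_spectral[P [d [PP ->]]]; rewrite ind_diag //.
set k := #|_|; pose f (i : 'I_k) : 'I_n := enum_val i.
have f_lt0 i : d 0 (f i) < 0 by have := enum_valP i; rewrite inE.
pose E (c : 'I_k -> R) : 'M[R]_(k, n) := \matrix_(i, j) (c i *+ (f i == j)).
have EP c : E c *m P *m (P^T *m diag_mx d *m P) =
    E (fun i => c i * d 0 (f i)) *m P.
  rewrite !mulmxA -(mulmxA _ P) PP mulmx1; congr (_ *m _).
  apply/matrixP => i j; rewrite mul_mx_diag !mxE.
  by case: eqP => [->|_]; rewrite ?mulr0n ?mul0r ?mulr1n.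
pose s i := (Num.sqrt (- d 0 (f i)))^-1.
exists (E s *m P), (E (fun i => s i / d 0 (f i)) *m P); split; last first.
  rewrite EP; congr (_ *m _); apply/matrixP => i j; rewrite !mxE.
  by rewrite divfK // lt_eqF.
rewrite EP trmx_mul !mulmxA -(mulmxA _ P) PP mulmx1.
apply/matrixP => i j; rewrite mxE (bigD1 (f i)) //= big1 ?addr0; last first.
  by move=> l; rewrite !mxE eq_sym => /negPf ->; rewrite mulr0n mul0r.
rewrite !mxE eqxx mulr1n; rewrite (inj_eq enum_val_inj) [j == i]eq_sym.
have [<-|_] := eqVneq i j; last by rewrite !mulr0n mulr0 oppr0.
rewrite !mulr1n /s mulrAC -expr2 exprVn sqr_sqrtr ?oppr_ge0 1?ltW //.
by rewrite invrN mulNr mulVf // lt_eqF.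
Qed.

Lemma ind_rank (R : realType) (n : nat) (A : 'M[R]_n) :
  A^T = A -> (ind A + ind (- A))%N = \rank A.
Proof.
move=> /sym_spectral[P [d [PP ->]]].
have -> : - (P^T *m diag_mx d *m P) = P^T *m diag_mx (- d) *m P.
  by rewrite linearN /= mulmxN mulNmx.
rewrite !ind_diag //; have uP : P \in unitmx by case/mulmx1_unit: PP.
rewrite mxrankMfree ?row_free_unit // -mxrank_tr trmx_mul trmxK tr_diag_mx.
rewrite mxrankMfree ?row_free_unit // rank_diag -!sum1_card.
rewrite big_mkcond [X in (_ + X)%N]big_mkcond -big_split /=.
by apply: eq_bigr => i _; rewrite !inE mxE oppr_lt0; case: ltgtP.
Qed.

Lemma ind_congr_le (R : realType) (m n : nat) (C : 'M[R]_(m, n)) (A : 'M[R]_n) :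
  A^T = A -> (ind (C *m A *m C^T) <= ind A)%N.
Proof.
move=> symA; have symC : (C *m A *m C^T)^T = C *m A *m C^T.
  by rewrite !trmx_mul trmxK symA mulmxA.
have [V [_ [VC _]]] := ind_certificate symC.
apply: (@ind_lowerN1 _ _ _ _ (V *m C)) => //.
by rewrite -VC trmx_mul !mulmxA.
Qed.

Lemma ind_congr (R : realType) (n : nat) (C A : 'M[R]_n) :
  C \in unitmx -> A^T = A -> ind (C *m A *m C^T) = ind A.
Proof.
move=> uC symA; apply/eqP; rewrite eqn_leq ind_congr_le //=.
have {1}-> : A = invmx C *m (C *m A *m C^T) *m (invmx C)^T.
  rewrite !mulmxA mulVmx // mul1mx -mulmxA -trmx_mul mulVmx //.
  by rewrite trmx1 mulmx1.
by apply: ind_congr_le; rewrite !trmx_mul trmxK symA mulmxA.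
Qed.

(** The rows of the two certificates lie in the images of [A] and of [B], which annihilate each
    other, so stacking them gives a block form without cross terms. *)
Lemma ind_orth_ge (R : realType) (n : nat) (A B : 'M[R]_n) :
  A^T = A -> B^T = B -> A *m B = 0 -> (ind A + ind B <= ind (A + B))%N.
Proof.
move=> symA symB AB0.
have BA0 : B *m A = 0 by rewrite -symA -symB -trmx_mul AB0 trmx0.
have [V [Z [VA VE]]] := ind_certificate symA.
have [W [X [WB WE]]] := ind_certificate symB.
move: (ind A) (ind B) V Z VA VE W X WB WE => k l V Z VA VE W X WB WE.
apply: (@ind_lowerN1 _ _ _ _ (col_mx V W)); first by rewrite linearD /= symA
  symB.
have VB : V *m B = 0 by rewrite VE -mulmxA AB0 mulmx0.
have WA : W *m A = 0 by rewrite WE -mulmxA BA0 mulmx0.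
rewrite tr_col_mx mul_col_mx !mulmxDr VB WA addr0 add0r mul_col_row VA WB.
have -> : V *m A *m W^T = 0 by rewrite -mulmxA -symA -trmx_mul WA trmx0 mulmx0.
have -> : W *m B *m V^T = 0 by rewrite -mulmxA -symB -trmx_mul VB trmx0 mulmx0.
by rewrite [in RHS]scalar_mx_block opp_block_mx !oppr0.
Qed.

(** The inequality of [ind_orth_ge] for the pair and for the opposite pair adds up to
    [\rank A + \rank B <= \rank (A + B)]; subadditivity of the rank forces equality in both. *)
Lemma ind_orth (R : realType) (n : nat) (A B : 'M[R]_n) :
  A^T = A -> B^T = B -> A *m B = 0 -> ind (A + B) = (ind A + ind B)%N.
Proof.
move=> symA symB AB0; have symAB : (A + B)^T = A + B by rewrite linearD /= symA
  symB.
have le1 := ind_orth_ge symA symB AB0.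
have le2 : (ind (- A) + ind (- B) <= ind (- (A + B)))%N.
  by rewrite opprD ind_orth_ge // ?linearN /= ?symA ?symB // mulNmx AB0 !oppr0.
have := mxrank_add A B.
rewrite -(ind_rank symA) -(ind_rank symB) -(ind_rank symAB) => le3.
apply/eqP; rewrite eqn_leq le1 andbT.
by lia.
Qed.

Lemma ind_ul (R : realType) (m n : nat) (A : 'M[R]_m) : A^T = A ->
  ind (block_mx A 0 0 (0 : 'M[R]_n)) = ind A.
Proof.
move=> symA; set B := block_mx _ _ _ _.
have symB : B^T = B by rewrite /B tr_block_mx !trmx0 symA.
have BE : B = col_mx 1%:M 0 *m A *m (col_mx 1%:M 0)^T.
  rewrite tr_col_mx mul_col_mx trmx0 trmx1 mul_col_row.
  by rewrite !(mul1mx, mul0mx, mulmx1, mulmx0).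
have AE : A = row_mx 1%:M (0 : 'M[R]_(m, n)) *m B *m (row_mx 1%:M (0 :
  'M[R]_(m, n)))^T.
  rewrite tr_row_mx trmx0 trmx1 /B mul_row_block mul_row_col.
  by rewrite !(mul1mx, mul0mx, mulmx1, mulmx0, addr0, add0r).
apply/eqP; rewrite eqn_leq; apply/andP; split.
  by rewrite BE ind_congr_le.
by rewrite {1}AE ind_congr_le.
Qed.

Lemma ind_dr (R : realType) (m n : nat) (A : 'M[R]_n) : A^T = A ->
  ind (block_mx (0 : 'M[R]_m) 0 0 A) = ind A.
Proof.
move=> symA; set B := block_mx _ _ _ _.
have symB : B^T = B by rewrite /B tr_block_mx !trmx0 symA.
have BE : B = col_mx 0 1%:M *m A *m (col_mx 0 1%:M)^T.
  rewrite tr_col_mx mul_col_mx trmx0 trmx1 mul_col_row.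
  by rewrite !(mul1mx, mul0mx, mulmx1, mulmx0).
have AE : A = row_mx (0 : 'M[R]_(n, m)) 1%:M *m B *m (row_mx (0 : 'M[R]_(n, m))
  1%:M)^T.
  rewrite tr_row_mx trmx0 trmx1 /B mul_row_block mul_row_col.
  by rewrite !(mul1mx, mul0mx, mulmx1, mulmx0, addr0, add0r).
apply/eqP; rewrite eqn_leq; apply/andP; split.
  by rewrite BE ind_congr_le.
by rewrite {1}AE ind_congr_le.
Qed.

Lemma ind_block_diag (R : realType) (m n : nat) (A : 'M[R]_m) (B : 'M[R]_n) :
  A^T = A -> B^T = B -> ind (block_mx A 0 0 B) = (ind A + ind B)%N.
Proof.
move=> symA symB; rewrite -(ind_ul n symA) -(ind_dr m symB).
have -> : block_mx A 0 0 B = block_mx A 0 0 0 + block_mx 0 0 0 B.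
  by rewrite add_block_mx !addr0 !add0r.
apply: ind_orth; rewrite ?tr_block_mx ?trmx0 ?symA ?symB //.
by rewrite mulmx_block !(mulmx0, mul0mx, addr0) -block_mx0.
Qed.

(* Conjugation by diag(1, -1) exchanges the form with its opposite. *)
Lemma ind_antidiag (R : realType) (m n : nat) (N : 'M[R]_(m, n)) :
  ind (block_mx 0 N N^T 0) = \rank N.
Proof.
set A := block_mx _ _ _ _.
have symA : A^T = A by rewrite /A tr_block_mx !trmx0 trmxK.
have rA : \rank A = (\rank N + \rank N)%N.
  pose s := block_mx 0 1%:M 1%:M 0 : 'M[R]_(n + m, m + n).
  have eN : A = block_mx N 0 0 N^T *m s.
    by rewrite /A /s mulmx_block !(mulmx0, mul0mx, mulmx1, addr0, add0r).
  have fs : row_free s.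
    apply/row_freeP; exists (block_mx 0 1%:M 1%:M 0).
    by rewrite mulmx_block !(mulmx0, mul0mx, mulmx1, addr0, add0r)
      -scalar_mx_block.
  by rewrite eN mxrankMfree // rank_diag_block_mx mxrank_tr.
have indN : ind (- A) = ind A.
  pose K : 'M[R]_(m + n) := block_mx 1%:M 0 0 (- 1%:M).
  have KK : K *m K = 1%:M.
    rewrite mulmx_block !(mulmx0, mul0mx, mulmx1, addr0, add0r).
    by rewrite mulmxN mulmx1 opprK -scalar_mx_block.
  have -> : - A = K *m A *m K^T.
    rewrite /K tr_block_mx linearN /= !trmx0 !trmx1 !mulmx_block.
    rewrite !(mulmx0, mul0mx, mul1mx, mulmx1, addr0, add0r).
    by rewrite mulmxN mulmx1 mulNmx mul1mx opp_block_mx !oppr0.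
  by apply: ind_congr => //; case/mulmx1_unit: KK.
have := ind_rank symA; rewrite indN rA; lia.
Qed.

(** * Haynsworth's inertia formula *)

(** Congruence by a unit lower triangular block matrix. The corner [E] is free: one choice will
    clear part of [B], another one part of [D]. *)
Lemma ind_shear (R : realType) (m n : nat) (S : 'M[R]_m) (B : 'M[R]_(m, n))
    (D : 'M[R]_n) (E : 'M[R]_(n, m)) : S^T = S -> D^T = D ->
  ind (block_mx S B B^T D) =
  ind (block_mx S (B + S *m E^T) (B + S *m E^T)^T
        (D + E *m B + B^T *m E^T + E *m S *m E^T)).
Proof.
move=> symS symD; set A := block_mx S B B^T D.
have symA : A^T = A by rewrite /A tr_block_mx symS symD trmxK.
pose C : 'M[R]_(m + n) := block_mx 1%:M 0 E 1%:M.
have uC : C \in unitmx.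
  by rewrite unitmxE det_lblock !det1 mul1r unitr1.
rewrite -(ind_congr uC symA); congr ind.
rewrite /A /C tr_block_mx !trmx0 !trmx1 !mulmx_block.
rewrite !(mul1mx, mul0mx, mulmx1, mulmx0, addr0, add0r).
congr block_mx; first by rewrite addrC.
- by rewrite linearD /= trmx_mul trmxK symS addrC.
by rewrite mulmxDl addrC [E *m B + _]addrC [X in _ + X]addrC addrA.
Qed.

Lemma mulmx_mpinv (R : realType) (m n : nat) (N : 'M[R]_(m, n)) :
  N *m (1%:M - mpinv N *m N) = 0.
Proof. by have [N1 _ _ _] := mpinvP N; rewrite mulmxBr mulmx1 mulmxA N1 subrr.
  Qed.

Lemma tr_mpinv_proj (R : realType) (m n : nat) (N : 'M[R]_(m, n)) :
  (1%:M - mpinv N *m N)^T = 1%:M - mpinv N *m N.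
Proof. by have [_ _ _ N4] := mpinvP N; rewrite linearB /= trmx1 N4. Qed.

(** A shear with [E *m S = 0] leaves [S] and [N] alone and compresses [D] to [V *m D *m V]. The
    blocks [S], [N] and [V *m D *m V] then give pairwise orthogonal forms, whose indices add. *)
Lemma ind_degenerate_block (R : realType) (m n : nat) (S : 'M[R]_m)
    (N : 'M[R]_(m, n)) (D : 'M[R]_n) : S^T = S -> D^T = D -> S *m N = 0 ->
  let V := 1%:M - mpinv N *m N in
  ind (block_mx S N N^T D) = (ind S + \rank N + ind (V *m D *m V))%N.
Proof.
move=> symS symD SN0 V.
have symV : V^T = V := tr_mpinv_proj N.
have NV0 : N *m V = 0 := mulmx_mpinv N.
have VN0 : V *m N^T = 0 by rewrite -symV -trmx_mul NV0 trmx0.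
have [_ N2 N3 N4] := mpinvP N.
(* With [Q = mpinv N *m N] this gives [E *m N = 2^-1 *: (Q *m D *m Q) - D *m Q]: the factor one half
   shares the term [Q *m D *m Q] between [E *m N] and its transpose. *)
pose E := - ((1%:M - 2^-1 *: (mpinv N *m N)) *m D *m mpinv N).
have pinvS : mpinv N *m S = 0.
  have NS0 : N^T *m S = 0 by rewrite -symS -trmx_mul SN0 trmx0.
  have -> : mpinv N *m S = mpinv N *m (N *m mpinv N)^T *m S.
    by rewrite N3 mulmxA N2.
  by rewrite trmx_mul -!mulmxA NS0 !mulmx0.
have ES : E *m S = 0 by rewrite /E mulNmx -mulmxA pinvS mulmx0 oppr0.
have SE : S *m E^T = 0 by rewrite -[S *m E^T]trmxK trmx_mul trmxK symS ES trmx0.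
have NE : N^T *m E^T = (E *m N)^T by rewrite trmx_mul.
have symVDV : (V *m D *m V)^T = V *m D *m V by rewrite !trmx_mul symV symD
  mulmxA.
rewrite (ind_shear N E symS symD) SE ES mul0mx !addr0.
have -> : D + E *m N + N^T *m E^T = V *m D *m V.
  rewrite NE /V; move: N4; set Q := mpinv N *m N => symQ.
  have -> : E *m N = 2^-1 *: (Q *m D *m Q) - D *m Q.
    rewrite /E mulNmx -(mulmxA _ (mpinv N)) -/Q !mulmxBl mul1mx -!scalemxAl.
    by rewrite opprB.
  clearbody Q; rewrite [(_ - _)^T]linearB /= [(_ *: _)^T]linearZ /= !trmx_mul
    symD symQ !mulmxA.
  rewrite mulmxBl mul1mx !mulmxBr !mulmx1 mulmxBl.
  move: (Q *m D *m Q) (Q *m D) (D *m Q) => X1 X2 X3.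
  by apply/matrixP => i j; rewrite !mxE; field.
rewrite -ind_antidiag addnAC -(ind_block_diag symS symVDV).
have -> : block_mx S N N^T (V *m D *m V) =
    block_mx S 0 0 (V *m D *m V) + block_mx 0 N N^T 0.
  by rewrite add_block_mx !(addr0, add0r).
apply: ind_orth; rewrite ?tr_block_mx ?trmx0 ?trmxK ?symS ?symVDV //.
rewrite mulmx_block !(mulmx0, mul0mx, addr0, add0r) SN0 -(mulmxA _ V N^T) VN0
  mulmx0.
by rewrite -block_mx0.
Qed.

(** Haynsworth's formula for a possibly singular corner [S]. Only two Penrose equations are asked of
    [G], so that in [mu_chart] it can be adapted to the projector occurring in [ci_M] instead of
    being [mpinv] of the corner. *)
Lemma ind_block (R : realType) (m n : nat) (S G : 'M[R]_m) (B : 'M[R]_(m, n))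
    (D : 'M[R]_n) : S^T = S -> D^T = D ->
  S *m G *m S = S -> (S *m G)^T = S *m G ->
  let N := (1%:M - S *m G) *m B in let V := 1%:M - mpinv N *m N in
  ind (block_mx S B B^T D) =
    (ind S + \rank N + ind (V *m (D - B^T *m G *m B) *m V))%N.
Proof.
move=> symS symD SGS symSG N V.
have symV : V^T = V := tr_mpinv_proj N.
have BV : B *m V = S *m G *m B *m V.
  have := mulmx_mpinv N; rewrite -/V {1}/N => /eqP.
  by rewrite mulmxBl mul1mx mulmxBl subr_eq0 => /eqP.
have SN0 : S *m N = 0.
  have SSG : S *m (S *m G) = S by rewrite -symSG -{1}symS -trmx_mul SGS symS.
  by rewrite /N mulmxA mulmxBr mulmx1 SSG subrr mul0mx.
(* This shear replaces [B] by [N], its part outside the image of [S], and [D] by the generalized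
   Schur complement, up to the term [(G *m B)^T *m N], which [V] kills. *)
rewrite (ind_shear B (- (G *m B)^T) symS symD).
have -> : B + S *m (- (G *m B)^T)^T = N.
  by rewrite linearN /= trmxK mulmxN mulmxA /N mulmxBl mul1mx.
set K := (X in block_mx _ _ _ X).
have symK : K^T = K.
  rewrite /K !linearD /= !trmx_mul !trmxK symD symS -!addrA; congr (_ + _).
  by rewrite addrCA !mulmxA.
rewrite (ind_degenerate_block symS symK SN0); congr (_ + ind _)%N.
have -> : K = D - B^T *m G *m B - (G *m B)^T *m N.
  rewrite /K [(- _)^T]linearN /= trmxK !(mulmxN, mulNmx) opprK.
  rewrite /N mulmxBl mul1mx mulmxBr opprB !mulmxA.
  rewrite -!addrA; congr (_ + _); rewrite [LHS]addrCA; congr (_ + _).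
  by rewrite addrC.
have VNV : V *m ((G *m B)^T *m N) *m V = 0.
  by rewrite -2!mulmxA (mulmx_mpinv N : N *m V = 0) !mulmx0.
by rewrite [V *m (_ - _)]mulmxBr mulmxBl VNV subr0.
Qed.

(** * The comparative index in a chart *)

Lemma mpinvN (R : realType) (m n : nat) (A : 'M[R]_(m, n)) :
  mpinv (- A) = - mpinv A.
Proof.
apply: is_mpinv_uniq (mpinvP (- A)) _; have [A1 A2 A3 A4] := mpinvP A.
by split; rewrite !(mulmxN, mulNmx, opprK) ?A1 ?A2 ?A3 ?A4.
Qed.

Lemma wronskianE (R : realType) (n : nat) (Y Z : 'M[R]_(n + n, n)) :
  wronskian Y Z = (usubmx Y)^T *m dsubmx Z - (dsubmx Y)^T *m usubmx Z.
Proof.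
rewrite /wronskian /Jmx -{1}[Y]vsubmxK -{1}[Z]vsubmxK tr_col_mx.
rewrite mul_row_block mul_row_col !mulmx0 !mulmx1 mulmxN mulmx1 add0r addr0.
by rewrite mulNmx addrC.
Qed.

(* [den q Y] is invertible iff Y is transversal to [q_plane n q], and Y is then
   the image of (S; 1 + q S) for the symmetric matrix S = [chart q Y]. *)
Definition q_plane (R : realType) (n : nat) (q : R) : 'M[R]_(n + n, n) :=
  col_mx 1%:M q%:M.

Definition den (R : realType) (n : nat) (q : R) (Y : 'M[R]_(n + n, n)) :
    'M[R]_n :=
  dsubmx Y - q *: usubmx Y.

Definition chart (R : realType) (n : nat) (q : R) (Y : 'M[R]_(n + n, n)) :
    'M[R]_n :=
  usubmx Y *m invmx (den q Y).

Lemma wronskian_den (R : realType) (n : nat) (q : R) (Y Z : 'M[R]_(n + n, n)) :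
  wronskian Y Z = (usubmx Y)^T *m den q Z - (den q Y)^T *m usubmx Z.
Proof.
rewrite wronskianE /den mulmxBr [(_ - _)^T]linearB /= [(_ *: _)^T]linearZ /=.
by rewrite mulmxBl -scalemxAl -scalemxAr opprB addrA subrK.
Qed.

Lemma wronskian_q_plane (R : realType) (n : nat) (q : R) (Y : 'M[R]_(n + n, n)) :
  wronskian Y (q_plane n q) = - (den q Y)^T.
Proof.
rewrite (wronskian_den q) /den /q_plane col_mxKu col_mxKd scalemx1 subrr.
by rewrite mulmx0 mulmx1 add0r.
Qed.

Lemma chartK (R : realType) (n : nat) (q : R) (Y : 'M[R]_(n + n, n)) :
  den q Y \in unitmx -> chart q Y *m den q Y = usubmx Y.
Proof. by move=> uY; rewrite mulmxKV. Qed.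

Lemma lagrangian_den (R : realType) (n : nat) (q : R) (Y : 'M[R]_(n + n, n)) :
  lagrangian Y -> (usubmx Y)^T *m den q Y = (den q Y)^T *m usubmx Y.
Proof.
by case; rewrite -/(wronskian Y Y) (wronskian_den q) => /eqP + _;
  rewrite subr_eq0 => /eqP.
Qed.

Lemma chart_sym (R : realType) (n : nat) (q : R) (Y : 'M[R]_(n + n, n)) :
  lagrangian Y -> den q Y \in unitmx -> (chart q Y)^T = chart q Y.
Proof.
move=> /(lagrangian_den q) YY uY; rewrite /chart trmx_mul trmx_inv.
rewrite -[(usubmx Y)^T](mulmxK uY) YY !mulmxA mulVmx ?unitmx_tr //.
by rewrite mul1mx.
Qed.

Lemma wronskian_chart (R : realType) (n : nat) (q : R) (Y Z : 'M[R]_(n + n, n)) :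
  lagrangian Y -> den q Y \in unitmx -> den q Z \in unitmx ->
  wronskian Y Z = (den q Y)^T *m (chart q Y - chart q Z) *m den q Z.
Proof.
move=> lagY uY uZ; rewrite (wronskian_den q).
rewrite [(den q Y)^T *m (_ - _)]mulmxBr [(_ - _) *m den q Z]mulmxBl.
rewrite -mulmxA -[in RHS]mulmxA !chartK // -{1}(chartK uY).
by rewrite trmx_mul chart_sym // mulmxA.
Qed.

Lemma rank_chart (R : realType) (n : nat) (q : R) (Y : 'M[R]_(n + n, n)) :
  den q Y \in unitmx -> \rank (chart q Y) = \rank (usubmx Y).
Proof.
by move=> uY; rewrite /chart mxrankMfree // row_free_unit unitmx_inv.
Qed.

Lemma rank_wronskian_chart (R : realType) (n : nat) (q : R)
    (Y Z : 'M[R]_(n + n, n)) :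
  lagrangian Y -> den q Y \in unitmx -> den q Z \in unitmx ->
  \rank (wronskian Y Z) = \rank (chart q Y - chart q Z).
Proof.
move=> lagY uY uZ; rewrite (wronskian_chart lagY uY uZ).
rewrite mxrankMfree ?row_free_unit // -mxrank_tr trmx_mul trmxK.
by rewrite mxrankMfree ?row_free_unit // mxrank_tr.
Qed.

(** The index of the matrix with blocks [C^T *m X], [C^T *m XZ], its transpose and [D^T *m XZ] is
    computed twice: by [ind_block], which produces the rank and the index in [mu], and by congruence
    with the diagonal blocks [S - T] and [T]. *)
Lemma mu_chart (R : realType) (n : nat) (q : R) (Y Z : 'M[R]_(n + n, n)) :
  lagrangian Y -> lagrangian Z ->
  den q Y \in unitmx -> den q Z \in unitmx ->
  (mu Y Z + ind (chart q Y) =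
   ind (chart q Y - chart q Z)%R + ind (chart q Z))%N.
Proof.
move=> lagY lagZ uY uZ.
have symS := chart_sym lagY uY; have symT := chart_sym lagZ uZ.
set S := chart q Y in symS *; set T := chart q Z in symT *.
pose X := usubmx Y; pose C := den q Y; pose XZ := usubmx Z; pose D := den q Z.
have SC : S *m C = X by exact: chartK.
have TD : T *m D = XZ by exact: chartK.
have XC : X^T *m C = C^T *m X by exact: lagrangian_den.
have XD : XZ^T *m D = D^T *m XZ by exact: lagrangian_den.
have [X1 X2 X3 X4] := mpinvP X; set Xi := mpinv X in X1 X2 X3 X4.
have XiXt : Xi *m X *m X^T = X^T by rewrite -X4 -trmx_mul mulmxA X1.
(* A generalized inverse of [C^T *m X] chosen so that [C^T *m X *m G] is the projector [Xi *m X] of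
   [ci_M]. *)
pose G := invmx C *m Xi^T.
have SG : C^T *m X *m G = Xi *m X.
  by rewrite -XC /G mulmxA (mulmxK uY) -trmx_mul X4.
have symS' : (C^T *m X)^T = C^T *m X by rewrite trmx_mul trmxK XC.
have symT' : (D^T *m XZ)^T = D^T *m XZ by rewrite trmx_mul trmxK XD.
have SGS : C^T *m X *m G *m (C^T *m X) = C^T *m X.
  by rewrite SG -XC mulmxA XiXt.
have symSG : (C^T *m X *m G)^T = C^T *m X *m G by rewrite SG X4.
have := ind_block (C^T *m XZ) symS' symT' SGS symSG.
rewrite /= SG; set N := (1%:M - Xi *m X) *m (C^T *m XZ).
set V := 1%:M - mpinv N *m N => indN.
have ME : ci_M Y Z = - N.
  rewrite /ci_M (wronskian_den q) -/X -/Xi -/C -/D -/XZ mulmxBr mulmxA.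
  by rewrite [_ *m X^T]mulmxBl mul1mx XiXt subrr mul0mx sub0r.
have VE : ci_V Y Z = V by rewrite /ci_V ME mpinvN mulNmx mulmxN opprK.
have symV : V^T = V := tr_mpinv_proj N.
have NV0 : N *m V = 0 := mulmx_mpinv N.
clearbody V.
(* On the image of [V] the block [XZ] factors through [X], so that the pseudoinverses in the
   products below cancel. *)
pose Q := Xi *m (XZ *m V).
have XZV : XZ *m V = X *m Q.
  have CXZ : C^T *m (XZ *m V) = X^T *m (Xi^T *m (C^T *m (XZ *m V))).
    rewrite !mulmxA -trmx_mul X4; apply/eqP; rewrite -subr_eq0.
    by rewrite -NV0 /N !mulmxBl mul1mx !mulmxA.
  have : XZ *m V = S *m (Xi^T *m (C^T *m (XZ *m V))).
    have uCt : C^T \in unitmx by rewrite unitmx_tr.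
    rewrite -[LHS](mulKmx uCt) {1}CXZ -{1}SC trmx_mul symS.
    by rewrite !mulmxA mulVmx // mul1mx.
  rewrite -(mulmxK uY S) SC -mulmxA; move: (invmx C *m _) => Q' XZV.
  by rewrite /Q XZV !mulmxA X1.
clearbody Q.
have X1r (Z' : 'M[R]_n) : X *m (Xi *m (X *m Z')) = X *m Z'.
  by rewrite !mulmxA X1.
have X1t (Z' : 'M[R]_n) : X^T *m (Xi^T *m (X^T *m Z')) = X^T *m Z'.
  by rewrite -{3}X1 !trmx_mul !mulmxA.
have VXZ : V *m XZ^T = Q^T *m X^T by rewrite -{1}symV -trmx_mul XZV trmx_mul.
have CG : C *m G = Xi^T by exact: mulKVmx.
have PE : ci_P Y Z = V *m (D^T *m XZ - (C^T *m XZ)^T *m G *m (C^T *m XZ)) *m V.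
  rewrite /ci_P VE (wronskian_den q) -/X -/Xi -/C -/D -/XZ.
  rewrite [(_ - _)^T]linearB /= !trmx_mul !trmxK.
  have E1 : V *m (D^T *m X) *m Xi *m XZ *m V = V *m (D^T *m XZ) *m V.
    by rewrite -!mulmxA XZV X1r.
  have E2 : V *m (XZ^T *m C) *m Xi *m XZ *m V = Q^T *m (X^T *m C) *m Q.
    by rewrite (mulmxA V) VXZ -!mulmxA XZV !(mulmxA X^T) XC -!mulmxA X1r.
  have E3 : V *m (XZ^T *m C *m G *m (C^T *m XZ)) *m V = Q^T *m (X^T *m C) *m Q.
    rewrite -(mulmxA XZ^T) CG !mulmxA VXZ -!mulmxA XZV (mulmxA C^T) -XC.
    by rewrite -!mulmxA X1t.
  have BL (A B : 'M[R]_n) : V *m (A - B) *m Xi *m XZ *m V =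
      V *m A *m Xi *m XZ *m V - V *m B *m Xi *m XZ *m V.
    by rewrite mulmxBr !mulmxBl.
  have BR (A B : 'M[R]_n) : V *m (A - B) *m V = V *m A *m V - V *m B *m V.
    by rewrite mulmxBr mulmxBl.
  by rewrite BL BR E1 E2 E3.
have indB : ind (block_mx (C^T *m X) (C^T *m XZ) (C^T *m XZ)^T (D^T *m XZ)) =
    (ind (S - T)%R + ind T)%N.
  have symST : (S - T)^T = S - T by rewrite linearB /= symS symT.
  rewrite -(ind_block_diag symST symT).
  (* The shear sending the diagonal blocks [S - T], [T] to the matrix with blocks [S], [T], [T],
     [T], followed by the change of basis [C^T], [D^T]. *)
  pose K : 'M[R]_(n + n) := block_mx C^T C^T 0 D^T.
  have -> : block_mx (C^T *m X) (C^T *m XZ) (C^T *m XZ)^T (D^T *m XZ) =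
     K *m block_mx (S - T) 0 0 T *m K^T.
    have DTC : (C^T *m XZ)^T = D^T *m T *m C.
      by rewrite trmx_mul trmxK -TD trmx_mul symT.
    rewrite /K tr_block_mx !trmxK trmx0 !mulmx_block DTC.
    rewrite !(mulmx0, mul0mx, addr0, add0r) -mulmxDl -mulmxDr subrK.
    by rewrite -SC -TD !mulmxA.
  have uCt : C^T \in unitmx by rewrite unitmx_tr.
  have uDt : D^T \in unitmx by rewrite unitmx_tr.
  apply: ind_congr; last by rewrite tr_block_mx !trmx0 symST symT.
  by rewrite unitmxE det_ublock unitrM -!unitmxE uCt uDt.
have indS : ind (C^T *m X) = ind S.
  by rewrite -SC mulmxA -{2}[C]trmxK ind_congr // unitmx_tr.
rewrite /mu ME mxrank_opp PE -indB indN indS.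
by rewrite addnC addnA.
Qed.

(** A separate computation is made because [den q (q_plane n q) = 0] puts this plane outside the
    chart of [mu_chart]. The rank term is [n - \rank S] and [ci_P] has the index of [- S], so that
    [ind_rank] concludes. *)
Lemma mu_q_plane (R : realType) (n : nat) (q : R) (Y : 'M[R]_(n + n, n)) :
  lagrangian Y -> den q Y \in unitmx ->
  (mu Y (q_plane n q) + ind (chart q Y) = n)%N.
Proof.
move=> lagY uY.
have symS := chart_sym lagY uY; set S := chart q Y in symS *.
pose X := usubmx Y; pose C := den q Y.
have SC : S *m C = X by exact: chartK.
have XC : X^T *m C = C^T *m X by exact: lagrangian_den.
have uCt : C^T \in unitmx by rewrite unitmx_tr.
have [X1 X2 X3 X4] := mpinvP X; set Xi := mpinv X in X1 X2 X3 X4.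
have XiXt : Xi *m X *m X^T = X^T by rewrite -X4 -trmx_mul mulmxA X1.
have ME : ci_M Y (q_plane n q) = - ((1%:M - Xi *m X) *m C^T).
  by rewrite /ci_M wronskian_q_plane mulmxN.
have rM : \rank (ci_M Y (q_plane n q)) = (n - \rank S)%N.
  rewrite ME mxrank_opp mxrankMfree ?row_free_unit // rank_chart // -/X.
  apply/eqP; rewrite -(eqn_add2r (\rank X)) subnK ?rank_leq_row //.
  rewrite eqn_leq; apply/andP; split.
    have XQ0 : X *m (1%:M - Xi *m X) = 0 by rewrite mulmxBr mulmx1 mulmxA X1
      subrr.
    by rewrite addnC mulmx0_rank_max.
  rewrite -{1}(mxrank1 R n) -{1}[1%:M](subrK (Xi *m X)).
  by rewrite (leq_trans (mxrank_add _ _)) // leq_add2l mxrankM_maxr.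
set V := ci_V Y (q_plane n q).
have symV : V^T = V := tr_mpinv_proj _.
have MV0 : ci_M Y (q_plane n q) *m V = 0 := mulmx_mpinv _.
have PE : ci_P Y (q_plane n q) = - (V *m C *m Xi *m V).
  rewrite /ci_P -/V wronskian_q_plane [(- _)^T]linearN /= trmxK -/C -/X -/Xi.
  by rewrite /q_plane col_mxKu mulmx1 mulmxN !mulNmx.
have CtS : C^T *m S = X^T by rewrite -symS -trmx_mul SC.
have VS : V *m S = S.
  rewrite /V /ci_V mulmxBl mul1mx -mulmxA [ci_M _ _ *m S](_ : _ = 0).
    by rewrite mulmx0 subr0.
  by rewrite ME mulNmx -mulmxA CtS mulmxBl mul1mx XiXt subrr oppr0.
have SV : S *m V = S by rewrite -[LHS]trmxK trmx_mul symS symV VS.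
have CXiS : S *m (C *m Xi) *m S = S.
  by rewrite mulmxA SC -(mulmxK uY S) SC mulmxA X1.
clearbody S.
(* Two congruences by possibly singular matrices, this one and [PK], give the two inequalities
   between the indices of [ci_P] and [- S]. *)
have SPS : S *m ci_P Y (q_plane n q) *m S = - S.
  rewrite PE mulmxN mulNmx !mulmxA SV -(mulmxA _ V S) VS -(mulmxA S C).
  by rewrite CXiS.
have [K VE] : exists K, V = S *m K.
  exists (Xi^T *m (C^T *m V)).
  have : C^T *m V = Xi *m X *m (C^T *m V).
    move: MV0; rewrite ME mulNmx => /eqP; rewrite oppr_eq0 -mulmxA mulmxBl
      mul1mx.
    by rewrite subr_eq0 => /eqP.
  rewrite -X4 trmx_mul -CtS => E.
  by apply: (can_inj (mulKmx uCt)); rewrite {1}E !mulmxA.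
have PK : ci_P Y (q_plane n q) = K^T *m (- S) *m K^T^T.
  rewrite PE -{1}symV VE trmx_mul symS trmxK mulmxN mulNmx.
  by rewrite -{3}CXiS !mulmxA.
have symP : (ci_P Y (q_plane n q))^T = ci_P Y (q_plane n q).
  by rewrite PK !trmx_mul !trmxK linearN /= symS !mulmxA.
have symNS : (- S)^T = - S by rewrite linearN /= symS.
have indP : ind (ci_P Y (q_plane n q)) = ind (- S).
  apply/eqP; rewrite eqn_leq {1}PK ind_congr_le //=.
  by rewrite -SPS -{2}symS ind_congr_le.
rewrite /mu rM indP -addnA [(ind (- S) + _)%N]addnC ind_rank // subnK //.
exact: rank_leq_row.
Qed.

Lemma mu_triple (R : realType) (n : nat) (q : R) (Y Z : 'M[R]_(n + n, n)) :
  lagrangian Y -> lagrangian Z ->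
  den q Y \in unitmx -> den q Z \in unitmx ->
  (mu Y Z + mu Z (q_plane n q) =
   mu Y (q_plane n q) + ind (chart q Y - chart q Z)%R)%N.
Proof.
move=> lagY lagZ uY uZ; have := mu_chart lagY lagZ uY uZ.
by have := mu_q_plane lagY uY; have := mu_q_plane lagZ uZ; lia.
Qed.

(** * Local constancy *)

(** If the values 0, ..., n of [q] all failed, there would be nonzero [x i] with
    [x i *m U^T = i%:R *: (x i *m X^T)]. As with eigenvectors for distinct eigenvalues, symmetry of
    [X^T *m U] makes the [n.+1] vectors [x i *m X^T] orthogonal, while full rank of [Y] makes them
    nonzero. Their Gram matrix [G] would have rank [n.+1], yet it factors through dimension [n]. *)
Lemma den_unit_ex (R : realType) (n : nat) (Y : 'M[R]_(n + n, n)) :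
  lagrangian Y -> exists q, den q Y \in unitmx.
Proof.
move=> lagY; apply: contrapT => /forallNP bad.
have {bad} /fin_all_exists[x xP] (i : 'I_n.+1) : exists x : 'rV[R]_n,
    x != 0 /\ x *m (den i%:R Y)^T = 0.
  have : ~~ row_free (den i%:R Y)^T.
    by rewrite row_free_unit unitmx_tr; apply/negP; exact: bad.
  by rewrite -kermx_eq0 => /rowV0Pn[x /sub_kermxP xd x0]; exists x.
pose X := usubmx Y; pose U := dsubmx Y.
have UE i : x i *m U^T = i%:R *: (x i *m X^T).
  have [_] := xP i; rewrite /den [(_ - _)^T]linearB /= [(_ *: _)^T]linearZ /=.
  by rewrite mulmxBr -scalemxAr => /eqP; rewrite subr_eq0 => /eqP.
have XU : X^T *m U = U^T *m X.
  by have := lagrangian_den 0 lagY; rewrite /den scale0r subr0.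
pose V := \matrix_i x i; pose G := V *m X^T *m (V *m X^T)^T.
have GE i j : G i j = ((x i *m X^T) *m (x j *m X^T)^T) 0 0.
  have VE k l : (V *m X^T) k l = (x k *m X^T) 0 l.
    by rewrite -[x k](rowK x) -row_mul [RHS]mxE.
  rewrite [LHS]mxE [RHS]mxE; apply: eq_bigr => k _.
  by rewrite [_^T k j]mxE [_^T k 0]mxE !VE.
have Gij i j : i != j -> G i j = 0.
  move=> neq_ij.
  have : i%:R * G i j = j%:R * G i j.
    rewrite !GE.
    have -> : j%:R * (x i *m X^T *m (x j *m X^T)^T) 0 0 =
        ((x i *m X^T) *m (x j *m U^T)^T) 0 0.
      by rewrite UE [(_ *: _)^T]linearZ /= -scalemxAr [RHS]mxE.
    rewrite !trmx_mul !trmxK -!mulmxA !(mulmxA X^T) XU !mulmxA UE.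
    by rewrite -!scalemxAl [RHS]mxE.
  move=> /eqP; rewrite -subr_eq0 -mulrBl mulf_eq0 subr_eq0 eqr_nat.
  by rewrite (inj_eq val_inj) (negPf neq_ij) => /eqP.
have Gii i : G i i != 0.
  rewrite GE mulmx_trE !mxE eqxx mulr1n sumsq_eq0; have [x0 _] := xP i.
  apply: contra x0 => /eqP xX0.
  have xU0 : x i *m U^T = 0 by rewrite UE xX0 scaler0.
  have : x i *m Y^T = 0.
    by rewrite -[Y]vsubmxK tr_col_mx mul_mx_row xX0 xU0 row_mx0.
  have : row_free Y^T by rewrite /row_free mxrank_tr; case: lagY => _ ->.
  by move=> fY /eqP; rewrite mulmx_free_eq0.
have diagG : is_diag_mx G by apply/is_diag_mxP => i j /Gij.
have : \rank G = n.+1.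
  apply: mxrank_unit; rewrite unitmxE det_trig ?is_diag_mx_is_trig //.
  by rewrite unitfE; apply/prodf_neq0 => i _; exact: Gii.
apply/eqP; rewrite neq_ltn; apply/orP; left; rewrite ltnS.
rewrite (leq_trans (mxrankM_maxl _ _)) // (leq_trans (mxrankM_maxl _ _)) //.
exact: rank_leq_col.
Qed.

Lemma den_unit_common (R : realType) (n : nat) (Ys : seq 'M[R]_(n + n, n)) :
  (forall Y, Y \in Ys -> lagrangian Y) ->
  exists q, forall Y, Y \in Ys -> den q Y \in unitmx.
Proof.
move=> lagYs.
pose p (Y : 'M[R]_(n + n, n)) : {poly R} :=
  \det (map_mx polyC (dsubmx Y) - 'X *: map_mx polyC (usubmx Y)).
have pE q Y : (p Y).[q] = \det (den q Y).
  rewrite /p -horner_evalE -det_map_mx; congr (\det _).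
  by apply/matrixP => i j; rewrite !mxE /= horner_evalE !hornerE.
have p0 Y : Y \in Ys -> p Y != 0.
  move=> /lagYs/den_unit_ex[q]; rewrite unitmxE unitfE -pE.
  by apply: contraNneq => ->; rewrite horner0.
pose P := \prod_(Y <- Ys) p Y.
have P0 : P != 0 by rewrite prodf_seq_neq0; apply/allP => Y /p0.
(* These are [size P] distinct candidates, one more than the largest possible number of roots. *)
pose rs : seq R := [seq i%:R | i <- iota 0 (size P)].
have uniq_rs : uniq rs by rewrite map_inj_uniq ?iota_uniq //; exact: mulrIn
  (oner_neq0 _).
have /allPn[q _ Pq] : ~~ all (root P) rs.
  apply/negP => all_rs; have := max_poly_roots P0 all_rs uniq_rs.
  by rewrite size_map size_iota ltnn.
exists q => Y YYs; rewrite unitmxE unitfE -pE.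
by apply: contra Pq => pY; rewrite /P (big_rem Y) //= rootM; apply/orP; left.
Qed.

(** * Entrywise limits of matrices and semicontinuity of the index *)

Section MatrixLimits.
Context {R : realType} {F : set_system R} {FF : Filter F}.

(** Convergence is taken entrywise so that limits of products, determinants and inverses reduce to
    real limits; the filter will be that of neighbourhoods within an interval. *)
Definition mx_cvg (m n : nat) (A : R -> 'M[R]_(m, n)) (L : 'M[R]_(m, n)) :=
  forall i j, A x i j @[x --> F] --> L i j.

Lemma mx_cvg_of_cvg (m n : nat) (A : R -> 'M[R]_(m, n)) (L : 'M[R]_(m, n)) :
  A x @[x --> F] --> L -> mx_cvg A L.
Proof.
move=> AL i j; apply: (@continuous_cvg _ _ _ F FF A (fun M : 'M[R]_(m, n) => M
  i j)) => //.
exact: coord_continuous.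
Qed.

Lemma cvgr_sum (I : Type) (r : seq I) (f : I -> R -> R) (l : I -> R) :
  (forall i, f i x @[x --> F] --> l i) ->
  \sum_(i <- r) f i x @[x --> F] --> \sum_(i <- r) l i.
Proof. by move=> fl; apply: cvg_big => //; exact: add_continuous. Qed.

Lemma cvgr_prod (I : Type) (r : seq I) (f : I -> R -> R) (l : I -> R) :
  (forall i, f i x @[x --> F] --> l i) ->
  \prod_(i <- r) f i x @[x --> F] --> \prod_(i <- r) l i.
Proof. by move=> fl; apply: cvg_big => //; exact: mul_continuous. Qed.

Lemma mx_cvg_cst (m n : nat) (L : 'M[R]_(m, n)) : mx_cvg (fun=> L) L.
Proof. by move=> i j; exact: cvg_cst. Qed.

Lemma mx_cvgM (m n p : nat) (A : R -> 'M[R]_(m, n)) (B : R -> 'M[R]_(n, p)) L M :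
  mx_cvg A L -> mx_cvg B M -> mx_cvg (fun x => A x *m B x) (L *m M).
Proof.
move=> AL BM i j; rewrite mxE; under eq_fun do rewrite mxE.
by apply: cvgr_sum => k; apply: cvgM.
Qed.

Lemma mx_cvgB (m n : nat) (A B : R -> 'M[R]_(m, n)) L M :
  mx_cvg A L -> mx_cvg B M -> mx_cvg (fun x => A x - B x) (L - M).
Proof.
move=> AL BM i j; rewrite !mxE; under eq_fun do rewrite !mxE.
exact: cvgB.
Qed.

Lemma mx_cvgZ (m n : nat) (c : R -> R) (A : R -> 'M[R]_(m, n)) (a : R) L :
  c x @[x --> F] --> a -> mx_cvg A L ->
  mx_cvg (fun x => c x *: A x) (a *: L).
Proof.
by move=> ca AL i j; rewrite mxE; under eq_fun do rewrite mxE; exact: cvgM.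
Qed.

Lemma cvg_det (n : nat) (A : R -> 'M[R]_n) L :
  mx_cvg A L -> \det (A x) @[x --> F] --> \det L.
Proof.
move=> AL; rewrite /determinant; apply: cvgr_sum => s.
apply: cvgM; first exact: cvg_cst.
by apply: cvgr_prod => i; exact: AL.
Qed.

(** Cramer's rule. Since [invmx] returns its argument outside [unitmx], the formula is used only
    near the limit, where the determinant stays nonzero. *)
Lemma mx_cvgV (n : nat) (A : R -> 'M[R]_n) L : L \in unitmx ->
  mx_cvg A L ->
  (\forall x \near F, A x \in unitmx) /\ mx_cvg (fun x => invmx (A x)) (invmx
    L).
Proof.
move=> uL AL; have dL : \det L != 0 by rewrite -unitfE -unitmxE.
have dA := cvg_det AL.
have uA : \forall x \near F, A x \in unitmx.
  have /cvgrPdist_lt/(_ `|\det L|) := dA; rewrite normr_gt0 => /(_ dL).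
  apply: filterS => x; rewrite unitmxE unitfE; apply: contraTneq => ->.
  by rewrite subr0 ltxx.
split=> // i j.
have : (\det (A x))^-1 * \adj (A x) i j @[x --> F] --> (\det L)^-1 * \adj L i j.
  apply: cvgM; first exact: cvgV.
  rewrite mxE; under eq_fun do rewrite mxE; apply: cvgM; first exact: cvg_cst.
  by apply: cvg_det => k l; rewrite !mxE; under eq_fun do rewrite !mxE; exact:
    AL.
have -> : (\det L)^-1 * \adj L i j = invmx L i j by rewrite /invmx uL [RHS]mxE.
move=> h; apply: cvg_trans h; apply: near_eq_cvg.
by apply: filterS uA => x ux; rewrite /invmx ux [RHS]mxE.
Qed.

(** The neighbourhood does not depend on [x]: for entries within [e] of those of [- 1%:M], the error
    in the form is at most [e * k%:R] times the squared norm of [x]. *)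
Lemma near_neg_form (k : nat) (A : R -> 'M[R]_k) : mx_cvg A (- 1%:M) ->
  \forall s \near F, forall x : 'rV_k, x != 0 -> (x *m A s *m x^T) 0 0 < 0.
Proof.
(* The denominator is [k.+1], so that [e * k%:R < 1] and [k = 0] needs no separate case. *)
move=> AL; pose e : R := (k.+1%:R)^-1.
have e0 : 0 < e by rewrite invr_gt0 ltr0n.
have : \forall s \near F, forall ij : 'I_k * 'I_k,
    `|A s ij.1 ij.2 - (- 1%:M) ij.1 ij.2| < e.
  apply: filter_forall => -[i j] /=.
  by have /cvgrPdist_lt/(_ e e0) := AL i j; apply: filterS => s; rewrite distrC.
apply: filterS => s close x x0.
pose D := A s + 1%:M.
have DE i j : `|D i j| <= e.
  by have := ltW (close (i, j)); rewrite /= !mxE opprK.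
have -> : A s = D - 1%:M by rewrite addrK.
rewrite mulmxBr mulmx1 mulmxBl mulmx_trE !mxE eqxx mulr1n subr_lt0.
have s_gt0 : 0 < \sum_j x 0 j ^+ 2.
  by rewrite lt_neqAle sumsq_ge0 eq_sym sumsq_eq0 x0.
apply: (@le_lt_trans _ _ (e * k%:R * \sum_j x 0 j ^+ 2)); last first.
  rewrite gtr_pMl // mulrC ltr_pdivrMr ?ltr0n // mul1r ltr_nat //.
have term i j : x 0 i * D i j * x 0 j <= e / 2 * (x 0 i ^+ 2 + x 0 j ^+ 2).
  have := DE i j; rewrite ler_norml => /andP[D1 D2].
  have h1 : 0 <= (x 0 i + x 0 j) ^+ 2 by exact: sqr_ge0.
  have h2 : 0 <= (x 0 i - x 0 j) ^+ 2 by exact: sqr_ge0.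
  nra.
have -> : e * k%:R * \sum_j x 0 j ^+ 2 =
    \sum_j \sum_i e / 2 * (x 0 i ^+ 2 + x 0 j ^+ 2).
  under [RHS]eq_bigr do rewrite -mulr_sumr big_split /= sumr_const card_ord.
  rewrite -[RHS]mulr_sumr big_split /= sumr_const card_ord.
  under [X in _ * (_ + X)]eq_bigr do rewrite -mulr_natr.
  by rewrite -mulr_suml -mulr_natr; field.
apply: ler_sum => j _; rewrite mxE mulr_suml [x^T j 0]mxE.
by apply: ler_sum => i _; exact: term.
Qed.

Lemma near_ind_ge (n : nat) (A : R -> 'M[R]_n) L :
  L^T = L -> (\forall s \near F, (A s)^T = A s) -> mx_cvg A L ->
  \forall s \near F, (ind L <= ind (A s))%N.
Proof.
move=> symL symA AL; have [V [_ [VL _]]] := ind_certificate symL.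
have : mx_cvg (fun s => V *m A s *m V^T) (- 1%:M).
  rewrite -VL; apply: (@mx_cvgM _ _ _ _ (fun=> V^T)); last exact: mx_cvg_cst.
  by apply: (@mx_cvgM _ _ _ (fun=> V)) => //; exact: mx_cvg_cst.
move=> /near_neg_form; apply: filterS2 symA => s symAs negV.
exact: (ind_lower symAs negV).
Qed.

(** The indices of [A s] and [- A s] are both lower semicontinuous and their sum is the constant
    rank, so neither can jump. *)
Lemma near_ind_eq (n : nat) (A : R -> 'M[R]_n) L :
  L^T = L -> (\forall s \near F, (A s)^T = A s) -> mx_cvg A L ->
  (\forall s \near F, \rank (A s) = \rank L) ->
  \forall s \near F, ind (A s) = ind L.
Proof.
move=> symL symA AL rA.
have symNL : (- L)^T = - L by rewrite linearN /= symL.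
have geN : \forall s \near F, (ind (- L)%R <= ind (- A s)%R)%N.
  apply: near_ind_ge => //.
    by apply: filterS symA => s symAs; rewrite linearN /= symAs.
  by move=> i j; rewrite mxE; under eq_fun do rewrite mxE; exact: cvgN.
have ge := near_ind_ge symL symA AL.
apply: filterS (filterI (filterI symA rA) (filterI ge geN)).
move=> s [[symAs rAs] [ges geNs]].
by move: (ind_rank symAs) (ind_rank symL); rewrite rAs; lia.
Qed.

Lemma den_cvg (n : nat) (q : R) (Y : R -> 'M[R]_(n + n, n)) L :
  mx_cvg Y L -> mx_cvg (fun s => den q (Y s)) (den q L).
Proof.
move=> YL; apply: mx_cvgB.
  by move=> i j; rewrite !mxE; under eq_fun do rewrite !mxE; exact: YL.
apply: mx_cvgZ; first exact: cvg_cst.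
by move=> i j; rewrite !mxE; under eq_fun do rewrite !mxE; exact: YL.
Qed.

Lemma near_den_unit (n : nat) (q : R) (Y : R -> 'M[R]_(n + n, n)) L :
  mx_cvg Y L -> den q L \in unitmx -> \forall s \near F, den q (Y s) \in unitmx.
Proof. by move=> YL uL; have [] := mx_cvgV uL (den_cvg (q := q) YL). Qed.

Lemma chart_cvg (n : nat) (q : R) (Y : R -> 'M[R]_(n + n, n)) L :
  mx_cvg Y L -> den q L \in unitmx -> mx_cvg (fun s => chart q (Y s)) (chart q
    L).
Proof.
move=> YL uL; apply: mx_cvgM; last by have [] := mx_cvgV uL (den_cvg (q := q)
  YL).
by move=> i j; rewrite !mxE; under eq_fun do rewrite !mxE; exact: YL.
Qed.

Lemma near_mu_triple (n : nat) (q : R) (Y Z : R -> 'M[R]_(n + n, n)) LY LZ :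
  mx_cvg Y LY -> mx_cvg Z LZ -> lagrangian LY -> lagrangian LZ ->
  (\forall s \near F, lagrangian (Y s)) -> (\forall s \near F, lagrangian (Z
    s)) ->
  den q LY \in unitmx -> den q LZ \in unitmx ->
  (\forall s \near F, \rank (wronskian (Y s) (Z s)) = \rank (wronskian LY LZ))
    ->
  \forall s \near F,
    (mu (Y s) (Z s))%:Z - (mu (Y s) (q_plane n q))%:Z + (mu (Z s) (q_plane n
      q))%:Z =
    (mu LY LZ)%:Z - (mu LY (q_plane n q))%:Z + (mu LZ (q_plane n q))%:Z.
Proof.
move=> YL ZL lagLY lagLZ lagY lagZ uLY uLZ rW.
have uY := near_den_unit YL uLY; have uZ := near_den_unit ZL uLZ.
have : \forall s \near F,
    ind (chart q (Y s) - chart q (Z s)) = ind (chart q LY - chart q LZ).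
  apply: near_ind_eq.
  - by rewrite linearB /= !chart_sym.
  - near=> s; rewrite linearB /= !chart_sym //; by near: s.
  - by apply: mx_cvgB; apply: chart_cvg.
  - near=> s; rewrite -!rank_wronskian_chart //; by near: s.
move=> indE; near=> s.
have lagYs : lagrangian (Y s) by near: s.
have lagZs : lagrangian (Z s) by near: s.
have uYs : den q (Y s) \in unitmx by near: s.
have uZs : den q (Z s) \in unitmx by near: s.
have := mu_triple lagYs lagZs uYs uZs.
have -> : ind (chart q (Y s) - chart q (Z s)) = ind (chart q LY - chart q LZ).
  by near: s.
by have := mu_triple lagLY lagLZ uLY uLZ; lia.
Unshelve. all: by end_near.
Qed.

Lemma near_mu_q_plane (n : nat) (q : R) (Y : R -> 'M[R]_(n + n, n)) LY :
  mx_cvg Y LY -> lagrangian LY -> (\forall s \near F, lagrangian (Y s)) ->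
  den q LY \in unitmx ->
  (\forall s \near F, \rank (usubmx (Y s)) = \rank (usubmx LY)) ->
  \forall s \near F, mu (Y s) (q_plane n q) = mu LY (q_plane n q).
Proof.
move=> YL lagLY lagY uLY rX; have uY := near_den_unit YL uLY.
have indE : \forall s \near F, ind (chart q (Y s)) = ind (chart q LY).
  apply: near_ind_eq.
  - exact: chart_sym.
  - by near=> s; rewrite chart_sym //; near: s.
  - exact: chart_cvg.
  - by near=> s; rewrite !rank_chart //; near: s.
near=> s.
have lagYs : lagrangian (Y s) by near: s.
have uYs : den q (Y s) \in unitmx by near: s.
have := mu_q_plane lagYs uYs; have := mu_q_plane lagLY uLY.
have -> : ind (chart q (Y s)) = ind (chart q LY) by near: s.
by lia.
Unshelve. all: by end_near.
Qed.

End MatrixLimits.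

(** * Primitives of the oscillation number *)

Lemma cvg_of_mx_cvg (R : realType) (F : set_system R) (FF : Filter F) (m n :
    nat)
    (A : R -> 'M[R]_(m, n)) (L : 'M[R]_(m, n)) :
  mx_cvg (F := F) A L -> A x @[x --> F] --> L.
Proof.
move=> AL W [P nP PW]; apply: (@filterS _ F _ [set s | forall i j, P i j (A s i
  j)]).
  by move=> s Ps; apply: PW.
have : \forall s \near F, forall ij : 'I_m * 'I_n, P ij.1 ij.2 (A s ij.1 ij.2).
  by apply: filter_forall => -[i j]; exact: (AL i j _ (nP i j)).
by apply: filterS => s Ps i j; exact: (Ps (i, j)).
Qed.

Lemma path_mx_cvg (R : realType) (m n : nat) (c d x : R)
    (Y : R -> 'M[R]_(m, n)) :
  {within `[c, d], continuous Y} -> x \in `[c, d] ->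
  mx_cvg (F := within [set` `[c, d]] (nbhs x)) Y (Y x).
Proof. by move=> /subspace_continuousP YC xcd; apply: mx_cvg_of_cvg; exact: YC.
  Qed.

Lemma near_within_itv (R : realType) (c d x : R) (P : R -> Prop) :
  (forall s, s \in `[c, d] -> P s) ->
  \forall s \near within [set` `[c, d]] (nbhs x), P s.
Proof. by move=> cdP; apply: filterS (withinT _ _). Qed.

Lemma near_within_ball (R : realType) (c d x : R) (P : R -> Prop) :
  (\forall s \near within [set` `[c, d]] (nbhs x), P s) <->
  exists2 e : R, 0 < e & forall s, s \in `[c, d] -> `|x - s| < e -> P s.
Proof.
rewrite near_withinE; split.
  move=> /nbhs_ballP[e /= e0 eP]; exists e => // s scd xs.
  by apply: eP.
by move=> [e e0 eP]; apply/nbhs_ballP; exists e => //= s xs scd; exact: eP.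
Qed.

(** Induction along the interval, by the supremum of the points reached from [c]. The local
    hypothesis concerns only intervals with endpoint [x], and transitivity glues them. The relation
    [P] will stand both for equality of values and for the existence of data. *)
Lemma interval_chain (R : realType) (c d : R) (P : R -> R -> Prop) : c <= d ->
  (forall s u v, c <= s -> s <= u -> u <= v -> v <= d -> P s u -> P u v -> P s
    v) ->
  (forall x, x \in `[c, d] -> \forall s \near within [set` `[c, d]] (nbhs x),
     (s <= x -> P s x) /\ (x <= s -> P x s)) ->
  P c d.
Proof.
move=> cd Ptrans Ploc.
pose E : set R := [set x | c <= x <= d /\ P c x].
have Ec : E c.
  split; first by rewrite lexx cd.
  have ccd : c \in `[c, d] by rewrite in_itv /= lexx cd.
  have /near_within_ball[e e0 /(_ c ccd)] := Ploc c ccd.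
  by rewrite subrr normr0 => /(_ e0)[/(_ (lexx c))].
have ubE : ubound E d by move=> x [/andP[]].
have supE : has_sup E by split; [exists c | exists d].
have le_sup : sup E <= d by apply: ge_sup; [exists c |].
have ge_sup : c <= sup E by apply: sup_upper_bound.
have Ein : sup E \in `[c, d] by rewrite in_itv /= ge_sup le_sup.
have /near_within_ball[e e0 eP] := Ploc _ Ein.
have Psup : P c (sup E).
  have [x [/andP[cx xd] Pcx] lt_x] := sup_adherent e0 supE.
  have le_x : x <= sup E by apply: sup_upper_bound => //; split=> //; rewrite
    cx.
  apply: (Ptrans c x) => //.
  have [| |/(_ le_x)] // := eP x.
    by rewrite in_itv /= cx xd.
  by rewrite ger0_norm ?subr_ge0 // ltrBlDr -ltrBlDl.
(* A point beyond the supremum unless cut off by [d]; it is reached too, which is possible only if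
   it is [d]. *)
pose y := Num.min (sup E + e / 2) d.
have le_y : sup E <= y by rewrite le_min le_sup andbT; lra.
have yd : y <= d by rewrite ge_min lexx orbT.
have cy : c <= y by exact: le_trans le_y.
have ley : y <= sup E + e / 2 by rewrite ge_min lexx.
have Py : P c y.
  apply: (Ptrans c (sup E)) => //.
  have [| |_ /(_ le_y)] // := eP y.
    by rewrite in_itv /= cy yd.
  by rewrite distrC ger0_norm ?subr_ge0 //; lra.
have y_sup : y <= sup E.
  by apply: sup_upper_bound => //; split=> //; rewrite cy yd.
suff -> : d = y by [].
apply/eqP; rewrite eq_le yd andbT leNgt; apply/negP => y_d.
have yE : y = sup E + e / 2.
  by rewrite /y; rewrite /y minEle in y_d *; case: ifP y_d => // _; rewrite
    ltxx.
by move: y_sup; rewrite yE; lra.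
Qed.

Lemma locally_constant_itv (R : realType) (T : Type) (c d : R) (g : R -> T) :
  c <= d ->
  (forall x, x \in `[c, d] ->
     \forall s \near within [set` `[c, d]] (nbhs x), g s = g x) ->
  g c = g d.
Proof.
move=> cd gloc; apply: (@interval_chain _ c d (fun s u => g s = g u)) => //.
  by move=> s u v _ _ _ _ ->.
by move=> x xcd; apply: filterS (gloc x xcd) => s ->.
Qed.

Lemma lagrangian_q_plane (R : realType) (n : nat) (q : R) : lagrangian (q_plane
    n q).
Proof.
split.
  rewrite -/(wronskian _ _) wronskianE /q_plane !col_mxKu !col_mxKd.
  by rewrite !tr_scalar_mx mul1mx mulmx1 subrr.
apply/eqP; rewrite eqn_leq rank_leq_col /=.
rewrite -[leqLHS](mxrank1 R); have {1}-> : 1%:M = row_mx 1%:M 0 *m q_plane n q.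
  by rewrite mul_row_col mul0mx mulmx1 addr0.
exact: mxrankM_maxr.
Qed.

Lemma den_q_plane_unit (R : realType) (n : nat) (q q' : R) :
  q != q' -> den q (q_plane n q') \in unitmx.
Proof.
move=> neq_q; rewrite /den /q_plane col_mxKu col_mxKd scalemx1 -raddfB /=.
by rewrite unitmxE det_scalar unitfE expf_neq0 // subr_eq0 eq_sym.
Qed.

(** The functions whose increments are those of the oscillation number. The [q] may change with [x],
    as no single [q_plane] need be transversal to the whole path. *)
Definition osc_primitive (R : realType) (n : nat) (c d : R)
    (Y : R -> 'M[R]_(n + n, n)) (f : R -> int) :=
  forall x, x \in `[c, d] -> exists2 q, den q (Y x) \in unitmx &
    \forall s \near within [set` `[c, d]] (nbhs x),
      f s - (mu (Y s) (q_plane n q))%:Z = f x - (mu (Y x) (q_plane n q))%:Z.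

(** Change of [q]: [near_mu_triple] is applied to [Y] and the constant path [q_plane n q'], whose
    Wronskian has full rank because [den q' (Y s)] is invertible. *)
Lemma osc_primitive_all (R : realType) (n : nat) (c d x q : R)
    (Y : R -> 'M[R]_(n + n, n)) (f : R -> int) :
  lagrangian_path c d Y -> osc_primitive c d Y f -> x \in `[c, d] ->
  den q (Y x) \in unitmx ->
  \forall s \near within [set` `[c, d]] (nbhs x),
    f s - (mu (Y s) (q_plane n q))%:Z = f x - (mu (Y x) (q_plane n q))%:Z.
Proof.
move=> [contY lagY] primf xcd uq; have [q' uq' fq'] := primf x xcd.
have [->//|neq_q] := eqVneq q q'.
have YL := path_mx_cvg contY xcd.
have uq'near := near_den_unit YL uq'.
have lagYnear := near_within_itv x lagY.
have rankG Z : den q' Z \in unitmx -> \rank (wronskian Z (q_plane n q')) = n.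
  by move=> uZ; rewrite wronskian_q_plane mxrank_opp mxrank_unit // unitmx_tr.
have lagG := lagrangian_q_plane n q'.
have GL : mx_cvg (F := within [set` `[c, d]] (nbhs x))
    (fun=> q_plane n q') (q_plane n q') by exact: mx_cvg_cst.
have lagGn : \forall s \near within [set` `[c, d]] (nbhs x),
    lagrangian (q_plane n q') by exact: filterE.
have rWn : \forall s \near within [set` `[c, d]] (nbhs x),
    \rank (wronskian (Y s) (q_plane n q')) =
    \rank (wronskian (Y x) (q_plane n q')).
  near=> s; have us : den q' (Y s) \in unitmx by near: s; exact: uq'near.
  by rewrite !rankG.
have := near_mu_triple YL GL (lagY x xcd) lagG lagYnear lagGn uq
  (den_q_plane_unit n neq_q) rWn.
move=> triple; near=> s.
have fs : f s - (mu (Y s) (q_plane n q'))%:Z =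
    f x - (mu (Y x) (q_plane n q'))%:Z.
  by near: s.
suff : (mu (Y s) (q_plane n q'))%:Z - (mu (Y s) (q_plane n q))%:Z +
       (mu (q_plane n q') (q_plane n q))%:Z =
       (mu (Y x) (q_plane n q'))%:Z - (mu (Y x) (q_plane n q))%:Z +
       (mu (q_plane n q') (q_plane n q))%:Z by lia.
by near: s; exact: triple.
Unshelve. all: by end_near.
Qed.

(** * Symplectic matrices, their planes and the sums they define *)

Lemma symplectic_lagrangian (R : realType) (n : nat) (S : 'M[R]_(n + n)) :
  symplectic S -> lagrangian (S *m Emx R n).
Proof.
move=> sympS.
have EE : (Emx R n)^T *m Jmx R n *m Emx R n = 0.
  rewrite -/(wronskian _ _) wronskianE /Emx col_mxKu col_mxKd.
  by rewrite trmx0 mul0mx mulmx0 subr0.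
split.
  by rewrite trmx_mul -!mulmxA (mulmxA S^T) (mulmxA (S^T *m _)) sympS !mulmxA.
have uJ : Jmx R n \in unitmx.
  rewrite -row_free_unit; apply/row_freeP; exists (- Jmx R n).
  rewrite mulmxN /Jmx mulmx_block !(mulmx0, mul0mx, addr0, add0r) mul1mx mulmx1.
  by rewrite opp_block_mx !oppr0 opprK -scalar_mx_block.
have uS : S \in unitmx.
  move: uJ; rewrite -sympS unitmx_mul => /andP[_ //].
rewrite -mxrank_tr trmx_mul mxrankMfree ?row_free_unit ?unitmx_tr // mxrank_tr.
apply/eqP; rewrite eqn_leq rank_leq_col /=.
rewrite -[leqLHS](mxrank1 R); have {1}-> : 1%:M = row_mx 0 1%:M *m Emx R n.
  by rewrite mul_row_col mul0mx mulmx1 add0r.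
exact: mxrankM_maxr.
Qed.

(** It presents [q_plane] in the form that admissible data require, with a constant symplectic
    system. *)
Lemma symplectic_q_plane (R : realType) (n : nat) (q : R) :
  exists2 S, symplectic S & S *m Emx R n = q_plane n q.
Proof.
exists (block_mx 0 1%:M (- 1%:M) q%:M).
  rewrite /symplectic /Jmx tr_block_mx !mulmx_block !trmx0 !trmx1.
  rewrite [(- _)^T]linearN /= trmx1 tr_scalar_mx.
  rewrite !(mulmx0, mul0mx, mulmx1, mul1mx, mulmxN, mulNmx, addr0, add0r,
    opprK).
  by rewrite oppr0 addNr.
by rewrite /Emx mul_block_col !(mulmx0, mulmx1, add0r).
Qed.

Lemma rank_wronskianC (R : realType) (n : nat) (Y Z : 'M[R]_(n + n, n)) :
  \rank (wronskian Y Z) = \rank (wronskian Z Y).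
Proof.
rewrite -mxrank_tr !wronskianE [(_ - _)^T]linearB /= !trmx_mul !trmxK.
by rewrite -mxrank_opp opprB.
Qed.

(** On each subinterval the constancy of the two ranks gives [f] the same increment as the
    comparative index, and the sum telescopes. The value does not involve the data, so their choice
    does not matter. *)
Lemma osc_sum_primitive (R : realType) (n : nat) (a b : R)
    (Y : R -> 'M[R]_(n + n, n)) (f : R -> int) p t Q :
  lagrangian_path a b Y -> osc_primitive a b Y f -> admissible Y a b p t Q ->
  osc_sum Y p t Q = f b - f a.
Proof.
move=> pathY primf [t0 tp t_lt admQ]; have [contY lagY] := pathY.
have t_mono k l : (k <= l)%N -> (l <= p)%N -> t k <= t l.
  elim: l => [|l IHl]; first by rewrite leqn0 => /eqP->.
  rewrite leq_eqVlt => /orP[/eqP->//|]; rewrite ltnS => kl lp.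
  by apply: le_trans (IHl kl (ltnW lp)) _; exact/ltW/t_lt.
rewrite -t0 -tp -(telescope_sumr (fun k => f (t k))) // big_mkord.
apply: eq_bigr => k _; have kp := ltn_ord k.
have [contQ sympQ [r rW] [r' rX]] := admQ k kp.
set c := t k in contQ sympQ rW rX *; set d := t k.+1 in contQ sympQ rW rX *.
have cd : c <= d by exact/ltW/t_lt.
have ac : a <= c by rewrite -t0; apply: t_mono => //; exact: ltnW.
have db : d <= b by rewrite -tp; apply: t_mono.
have sub : [set` `[c, d]] `<=` [set` `[a, b]].
  by move=> x /=; rewrite !in_itv /= => /andP[cx xd];
     rewrite (le_trans ac cx) (le_trans xd db).
pose Z s := Q k s *m Emx R n.
have /eqP : f c - (mu (Y c) (Z c))%:Z = f d - (mu (Y d) (Z d))%:Z.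
  apply: (@locally_constant_itv _ _ c d (fun s => f s - (mu (Y s) (Z s))%:Z)
    cd).
  move=> x xcd; have xab : x \in `[a, b] := sub x xcd.
  have lagZx := symplectic_lagrangian (sympQ x xcd).
  have [|q uq] := @den_unit_common _ _ [:: Y x; Z x].
    by move=> M; rewrite !inE => /orP[] /eqP->; [exact: lagY | exact: lagZx].
  have uY : den q (Y x) \in unitmx by rewrite uq // !inE eqxx.
  have uZ : den q (Z x) \in unitmx by rewrite uq // !inE eqxx orbT.
  have fY := osc_primitive_all pathY primf xab uY.
  have YL := path_mx_cvg (continuous_subspaceW sub contY) xcd.
  have ZL : mx_cvg (F := within [set` `[c, d]] (nbhs x)) Z (Z x).
    apply: (@mx_cvgM _ _ _ _ _ _ (Q k) (fun=> Emx R n)); last exact: mx_cvg_cst.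
    exact: path_mx_cvg contQ xcd.
  have lagYn : \forall s \near within [set` `[c, d]] (nbhs x), lagrangian (Y s).
    by apply: near_within_itv => s scd; apply: lagY; exact: sub.
  have lagZn : \forall s \near within [set` `[c, d]] (nbhs x), lagrangian (Z s).
    by apply: near_within_itv => s scd; exact/symplectic_lagrangian/sympQ.
  have rWn : \forall s \near within [set` `[c, d]] (nbhs x),
      \rank (wronskian (Y s) (Z s)) = \rank (wronskian (Y x) (Z x)).
    by apply: near_within_itv => s scd; rewrite ![\rank (wronskian (Y _)
      _)]rank_wronskianC !rW.
  have rXE s : s \in `[c, d] -> \rank (usubmx (Z s)) = r'.
    move=> /rX; rewrite -mulmxA -/(Z s) -{1}[Z s]vsubmxK mul_row_col.
    by rewrite mul1mx mul0mx addr0.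
  have rXn : \forall s \near within [set` `[c, d]] (nbhs x),
      \rank (usubmx (Z s)) = \rank (usubmx (Z x)).
    by apply: near_within_itv => s scd; rewrite !rXE.
  have h1 := near_mu_triple YL ZL (lagY x xab) lagZx lagYn lagZn uY uZ rWn.
  have h2 := near_mu_q_plane ZL lagZx lagZn uZ rXn.
  have h3 := within_subset (nbhs_filter x) sub fY.
  near=> s => /=.
  have e1 : (mu (Y s) (Z s))%:Z - (mu (Y s) (q_plane n q))%:Z +
      (mu (Z s) (q_plane n q))%:Z = (mu (Y x) (Z x))%:Z -
      (mu (Y x) (q_plane n q))%:Z + (mu (Z x) (q_plane n q))%:Z.
    by near: s; exact: h1.
  have e2 : mu (Z s) (q_plane n q) = mu (Z x) (q_plane n q).
    by near: s; exact: h2.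
  have e3 : f s - (mu (Y s) (q_plane n q))%:Z = f x - (mu (Y x) (q_plane n
    q))%:Z.
    by near: s; exact: h3.
  by move: e1 e2 e3; lia.
by rewrite /Z => /eqP; lia.
Unshelve. all: by end_near.
Qed.

(** * Existence of primitives and of admissible data *)

Lemma lagrangian_path_sub (R : realType) (n : nat) (a b c d : R)
    (Y : R -> 'M[R]_(n + n, n)) :
  a <= c -> d <= b -> lagrangian_path a b Y -> lagrangian_path c d Y.
Proof.
move=> ac db [contY lagY].
have sub s : s \in `[c, d] -> s \in `[a, b].
  by rewrite !in_itv /= => /andP[cs sd]; rewrite (le_trans ac cs) (le_trans sd
    db).
split; last by move=> s /sub; exact: lagY.
by apply: continuous_subspaceW contY => s /= /sub.
Qed.

(** Both existence statements are bundled so that a single use of [interval_chain] proves them. *)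
Definition osc_data (R : realType) (n : nat) (Y : R -> 'M[R]_(n + n, n)) (c d :
    R) :=
  (exists f, osc_primitive c d Y f) /\ (exists p t Q, admissible Y c d p t Q).

(** A [q_plane] transversal all along serves as the constant plane of the data, and
    [mu (Y s) (q_plane n q)] as the primitive. *)
Lemma osc_data_chart (R : realType) (n : nat) (c d q : R)
    (Y : R -> 'M[R]_(n + n, n)) : c <= d ->
  (forall s, s \in `[c, d] -> den q (Y s) \in unitmx) -> osc_data Y c d.
Proof.
move=> cd uY; split.
  exists (fun s => (mu (Y s) (q_plane n q))%:Z) => x xcd.
  by exists q; [exact: uY | apply: near_within_itv => s _ /=; rewrite
    [LHS]subrr [RHS]subrr].
have [S sympS SE] := symplectic_q_plane n q.
have [<-|neq_cd] := eqVneq c d.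
  (* The partition points increase strictly, so a degenerate interval takes [p = 0]. *)
  by exists 0%N, (fun=> c), (fun=> fun=> S); split.
exists 1%N, (fun k => if k is 0%N then c else d), (fun=> fun=> S).
split=> // [[|//] _|[|//] _]; first by rewrite lt_neqAle neq_cd.
split=> //.
- by apply: continuous_subspaceT => s; exact: cvg_cst.
- exists n => s scd; rewrite rank_wronskianC SE wronskian_q_plane mxrank_opp.
  by rewrite mxrank_unit // unitmx_tr; exact: uY.
by exists (\rank (row_mx 1%:M 0 *m S *m Emx R n : 'M[R]_n)).
Qed.

Lemma osc_primitive_cat (R : realType) (n : nat) (c u d : R)
    (Y : R -> 'M[R]_(n + n, n)) (f g : R -> int) : c <= u -> u <= d ->
  lagrangian_path c d Y -> osc_primitive c u Y f -> osc_primitive u d Y g ->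
  osc_primitive c d Y (fun s => if s <= u then f s else g s - g u + f u).
Proof.
move=> cu ud pathY pf pg x xcd.
have [_ lagY] := pathY.
have [q uq] := den_unit_ex (lagY x xcd); exists q => //.
have path1 := lagrangian_path_sub (lexx c) ud pathY.
have path2 := lagrangian_path_sub cu (lexx d) pathY.
move: xcd; rewrite in_itv /= => /andP[cx xd].
apply/near_within_ball; have [lt_xu|lt_ux|eq_xu] := ltgtP x u.
- have xcu : x \in `[c, u] by rewrite in_itv /= cx ltW.
  have /near_within_ball[e e0 eP] := osc_primitive_all path1 pf xcu uq.
  exists (Num.min e (u - x)); first by rewrite lt_min e0 subr_gt0.
  move=> s; rewrite in_itv /= lt_min => /andP[cs sd] /andP[xs].
  rewrite ltr_norml => /andP[h1 h2].
  have su : s <= u by lra.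
  by rewrite su; apply: eP => //; rewrite in_itv /= cs su.
- have xud : x \in `[u, d] by rewrite in_itv /= xd ltW.
  have /near_within_ball[e e0 eP] := osc_primitive_all path2 pg xud uq.
  exists (Num.min e (x - u)); first by rewrite lt_min e0 subr_gt0.
  move=> s; rewrite in_itv /= lt_min => /andP[cs sd] /andP[xs].
  rewrite ltr_norml => /andP[h1 h2].
  have us : u < s by lra.
  rewrite leNgt us /=.
  have : g s - (mu (Y s) (q_plane n q))%:Z = g x - (mu (Y x) (q_plane n q))%:Z.
    by apply: eP => //; rewrite in_itv /= sd ltW.
  by clear; lia.
(* At the junction both one-sided neighbourhoods must use the same [q], which [osc_primitive_all]
   allows; the constant added to [g] makes the two pieces agree there. *)
subst x.
have xcu : u \in `[c, u] by rewrite in_itv /= cu lexx.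
have xud : u \in `[u, d] by rewrite in_itv /= ud lexx.
have /near_within_ball[e e0 eP] := osc_primitive_all path1 pf xcu uq.
have /near_within_ball[e' e'0 e'P] := osc_primitive_all path2 pg xud uq.
exists (Num.min e e'); first by rewrite lt_min e0.
move=> s; rewrite in_itv /= lt_min => /andP[cs sd] /andP[us us'].
case: (lerP s u) => [su|lt_us].
  by apply: eP => //; rewrite in_itv /= cs su.
have : g s - (mu (Y s) (q_plane n q))%:Z = g u - (mu (Y u) (q_plane n q))%:Z.
  by apply: e'P => //; rewrite in_itv /= sd ltW.
by clear; lia.
Qed.

Lemma admissible_cat (R : realType) (n : nat) (c u d : R)
    (Y : R -> 'M[R]_(n + n, n)) p1 t1 Q1 p2 t2 Q2 :
  admissible Y c u p1 t1 Q1 -> admissible Y u d p2 t2 Q2 ->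
  admissible Y c d (p1 + p2)
    (fun k => if (k <= p1)%N then t1 k else t2 (k - p1)%N)
    (fun k => if (k < p1)%N then Q1 k else Q2 (k - p1)%N).
Proof.
move=> [t10 t1p t1_lt adm1] [t20 t2p t2_lt adm2].
(* At index [p1] the concatenated time is still [t1 p1] while the system is already [Q2 0]; this is
   consistent because [t1 p1 = u = t2 0]. *)
have tE k : (if (p1 + k <= p1)%N then t1 (p1 + k)%N else t2 (p1 + k - p1)%N) =
  t2 k.
  rewrite addKn; case: ifP => // le_k.
  have -> : k = 0%N by lia.
  by rewrite addn0 t1p t20.
have split_k k : (k < p1 + p2)%N ->
    (k < p1)%N \/ exists2 j, (j < p2)%N & k = (p1 + j)%N.
  move=> kp; have [lt_k|le_k] := ltnP k p1; [by left | right].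
  by exists (k - p1)%N; lia.
split.
- by rewrite leq0n.
- by rewrite tE.
- move=> k /split_k[lt_k|[j jp ->]]; first by rewrite (ltnW lt_k) lt_k; exact:
  t1_lt.
  by rewrite -addnS !tE; exact: t2_lt.
move=> k /split_k[lt_k|[j jp ->]].
  by rewrite (ltnW lt_k) lt_k; exact: adm1.
have -> : (p1 + j < p1)%N = false by rewrite ltnNge leq_addr.
by rewrite -addnS !tE !addKn; exact: adm2.
Qed.

Lemma osc_data_ex (R : realType) (n : nat) (a b : R)
    (Y : R -> 'M[R]_(n + n, n)) : a <= b ->
  lagrangian_path a b Y -> osc_data Y a b.
Proof.
move=> ab pathY; have [contY lagY] := pathY.
apply: (interval_chain ab) => [s u v as_ su uv vb [[f pf] [p1 [t1 [Q1
  adm1]]]]|].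
  move=> [[g pg] [p2 [t2 [Q2 adm2]]]]; split.
    have path := lagrangian_path_sub as_ vb pathY.
    by exists (fun r => if r <= u then f r else g r - g u + f u);
      exact: osc_primitive_cat.
  by do 3!eexists; exact: admissible_cat adm1 adm2.
move=> x xab; have [q uq] := den_unit_ex (lagY x xab).
have YL := path_mx_cvg contY xab.
have /near_within_ball[e e0 eP] : \forall s \near within [set` `[a, b]] (nbhs
  x),
    den q (Y s) \in unitmx by exact: near_den_unit YL uq.
apply/near_within_ball; exists e => // s.
move: xab; rewrite !in_itv /= => /andP[ax xb] /andP[as_ sb].
rewrite ltr_norml => /andP[h1 h2].
(* Every point between [s] and [x] is also within [e] of [x], so one chart covers the interval
   between them. *)
split=> le; apply: (osc_data_chart (q := q)) => // r; rewrite in_itv /= =>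
  /andP[r1 r2];
  apply: eP; rewrite ?in_itv /= ?ltr_norml; apply/andP; split; lra.
Qed.

(** * Difference of the oscillation sums of two paths *)

Lemma wronskian_symplectic (R : realType) (n : nat) (S : 'M[R]_(n + n))
    (C D : 'M[R]_(n + n, n)) :
  symplectic S -> wronskian (S *m C) (S *m D) = wronskian C D.
Proof.
by move=> sympS; rewrite /wronskian trmx_mul -!mulmxA (mulmxA S^T)
  (mulmxA (S^T *m _)) sympS !mulmxA.
Qed.

Lemma osc_sum_diff (R : realType) (n : nat) (a b : R)
    (Y Z : R -> 'M[R]_(n + n, n)) r p t Q p' t' Q' : a <= b ->
  lagrangian_path a b Y -> lagrangian_path a b Z ->
  (forall s, s \in `[a, b] -> \rank (wronskian (Y s) (Z s)) = r) ->
  admissible Y a b p t Q -> admissible Z a b p' t' Q' ->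
  osc_sum Y p t Q - osc_sum Z p' t' Q' =
    (mu (Y b) (Z b))%:Z - (mu (Y a) (Z a))%:Z.
Proof.
move=> ab pathY pathZ rW admY admZ; have [[f pf] _] := osc_data_ex ab pathY.
have [contY lagY] := pathY; have [contZ lagZ] := pathZ.
(* With [G] the plane [q_plane n q], subtracting the locally constant combination of
   [near_mu_triple] from [f s - mu (Y s) G] leaves [g s - mu (Z s) G], as a primitive for [Z]
   requires. *)
pose g s := f s - (mu (Y s) (Z s))%:Z.
suff pg : osc_primitive a b Z g.
  rewrite (osc_sum_primitive pathY pf admY) (osc_sum_primitive pathZ pg admZ).
  by rewrite /g; lia.
move=> x xab.
have [|q uq] := @den_unit_common _ _ [:: Y x; Z x].
  by move=> M; rewrite !inE => /orP[] /eqP->; [exact: lagY | exact: lagZ].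
have uY : den q (Y x) \in unitmx by rewrite uq // !inE eqxx.
have uZ : den q (Z x) \in unitmx by rewrite uq // !inE eqxx orbT.
exists q => //.
have h1 := near_mu_triple (path_mx_cvg contY xab) (path_mx_cvg contZ xab)
  (lagY x xab) (lagZ x xab) (near_within_itv x lagY) (near_within_itv x lagZ)
    uY uZ.
have h2 := osc_primitive_all pathY pf xab uY.
near=> s.
have e1 : (mu (Y s) (Z s))%:Z - (mu (Y s) (q_plane n q))%:Z +
    (mu (Z s) (q_plane n q))%:Z = (mu (Y x) (Z x))%:Z -
    (mu (Y x) (q_plane n q))%:Z + (mu (Z x) (q_plane n q))%:Z.
  near: s; apply: h1; apply: near_within_itv => s sab; by rewrite !rW.
have e2 : f s - (mu (Y s) (q_plane n q))%:Z = f x - (mu (Y x) (q_plane n q))%:Z.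
  by near: s; exact: h2.
by rewrite /g; move: e1 e2; lia.
Unshelve. all: by end_near.
Qed.

(* diag(1, -1) is antisymplectic: it changes the sign of the Wronskian, hence
   that of [ci_P], and so exchanges the comparative index with its dual. *)
Definition Kmx (R : realType) (n : nat) : 'M[R]_(n + n) :=
  block_mx 1%:M 0 0 (- 1%:M).

Lemma tr_Kmx (R : realType) (n : nat) : (Kmx R n)^T = Kmx R n.
Proof. by rewrite /Kmx tr_block_mx !trmx0 [(- _)^T]linearN /= !trmx1. Qed.

Lemma Kmx_J (R : realType) (n : nat) : Kmx R n *m Jmx R n *m Kmx R n = - Jmx R
    n.
Proof.
rewrite /Kmx /Jmx !mulmx_block opp_block_mx.
by rewrite !(mulmx0, mul0mx, mulmx1, mul1mx, mulmxN, mulNmx, addr0, add0r,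
             opprK, oppr0).
Qed.

Lemma Kmx_unit (R : realType) (n : nat) : Kmx R n \in unitmx.
Proof.
by rewrite unitmxE /Kmx det_lblock det1 mul1r -scaleN1r detZ det1 mulr1 unitfE
  expf_neq0 // oppr_eq0 oner_neq0.
Qed.

Lemma wronskian_Kmx (R : realType) (n : nat) (Y Z : 'M[R]_(n + n, n)) :
  wronskian (Kmx R n *m Y) (Kmx R n *m Z) = - wronskian Y Z.
Proof.
rewrite /wronskian trmx_mul tr_Kmx -!mulmxA (mulmxA (Jmx R n)) (mulmxA (Kmx R
  n)).
by rewrite (mulmxA (Kmx R n)) Kmx_J mulNmx mulmxN.
Qed.

Lemma usubmx_Kmx (R : realType) (n : nat) (Y : 'M[R]_(n + n, n)) :
  usubmx (Kmx R n *m Y) = usubmx Y.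
Proof.
by rewrite -{1}[Y]vsubmxK /Kmx mul_block_col col_mxKu mul1mx mul0mx addr0.
Qed.

Lemma mu_Kmx (R : realType) (n : nat) (Y Z : 'M[R]_(n + n, n)) :
  mu (Kmx R n *m Y) (Kmx R n *m Z) = mu_dual Y Z.
Proof.
have ME : ci_M (Kmx R n *m Y) (Kmx R n *m Z) = - ci_M Y Z.
  by rewrite /ci_M wronskian_Kmx usubmx_Kmx mulmxN.
have VE : ci_V (Kmx R n *m Y) (Kmx R n *m Z) = ci_V Y Z.
  by rewrite /ci_V ME mpinvN mulNmx mulmxN opprK.
have PE : ci_P (Kmx R n *m Y) (Kmx R n *m Z) = - ci_P Y Z.
  rewrite /ci_P VE wronskian_Kmx !usubmx_Kmx [(- _)^T]linearN /=.
  by rewrite mulmxN !mulNmx.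
by rewrite /mu ME PE mxrank_opp.
Qed.

Lemma lagrangian_Kmx (R : realType) (n : nat) (Y : 'M[R]_(n + n, n)) :
  lagrangian Y -> lagrangian (Kmx R n *m Y).
Proof.
move=> [YY rY]; split.
  by rewrite -/(wronskian _ _) wronskian_Kmx /wronskian YY oppr0.
rewrite -mxrank_tr trmx_mul mxrankMfree ?mxrank_tr //.
by rewrite row_free_unit unitmx_tr Kmx_unit.
Qed.

Lemma continuous_mulmx_within (R : realType) (m n p q : nat) (c d : R)
    (A : 'M[R]_(m, n)) (Y : R -> 'M[R]_(n, p)) (B : 'M[R]_(p, q)) :
  {within `[c, d], continuous Y} ->
  {within `[c, d], continuous (fun s => A *m Y s *m B)}.
Proof.
move=> contY; apply/subspace_continuousP => x xcd; apply: cvg_of_mx_cvg.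
apply: (@mx_cvgM _ _ _ _ _ _ (fun s => A *m Y s) (fun=> B)); last exact:
  mx_cvg_cst.
apply: (@mx_cvgM _ _ _ _ _ _ (fun=> A) Y); first exact: mx_cvg_cst.
exact: path_mx_cvg.
Qed.

Lemma lagrangian_path_Kmx (R : realType) (n : nat) (a b : R)
    (Y : R -> 'M[R]_(n + n, n)) :
  lagrangian_path a b Y -> lagrangian_path a b (fun s => Kmx R n *m Y s).
Proof.
move=> [contY lagY]; split; last by move=> s /lagY; exact: lagrangian_Kmx.
have -> : (fun s => Kmx R n *m Y s) = (fun s => Kmx R n *m Y s *m 1%:M).
  by apply/funext => s; rewrite mulmx1.
exact: continuous_mulmx_within.
Qed.

Lemma Kmx_E (R : realType) (n : nat) : - Kmx R n *m Emx R n = Emx R n.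
Proof.
rewrite mulNmx /Kmx /Emx mul_block_col !(mulmx0, mul0mx, mulmx1, add0r).
by rewrite opp_col_mx oppr0 opprK.
Qed.

(** Two antisymplectic factors make the new system symplectic again. The right one is [- Kmx R n],
    which fixes [Emx R n], so the planes of the data are simply mapped by [Kmx R n]. *)
Lemma admissible_Kmx (R : realType) (n : nat) (a b : R)
    (Y : R -> 'M[R]_(n + n, n)) p t Q :
  admissible Y a b p t Q ->
  admissible (fun s => Kmx R n *m Y s) a b p t
    (fun k s => Kmx R n *m Q k s *m - Kmx R n).
Proof.
move=> [t0 tp t_lt admQ]; split=> // k kp.
have [contQ sympQ [r rW] [r' rX]] := admQ k kp.
have QE s : Kmx R n *m Q k s *m - Kmx R n *m Emx R n =
    Kmx R n *m (Q k s *m Emx R n) by rewrite -!mulmxA Kmx_E.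
split.
- exact: continuous_mulmx_within.
- move=> s /sympQ sympQs; rewrite /symplectic.
  transitivity (Kmx R n *m ((Q k s)^T *m (Kmx R n *m Jmx R n *m Kmx R n) *m Q k
    s)
                 *m Kmx R n).
    rewrite !trmx_mul [(- _)^T]linearN /= tr_Kmx !(mulmxN, mulNmx) opprK.
    by rewrite !mulmxA.
  by rewrite Kmx_J mulmxN mulNmx sympQs mulmxN mulNmx Kmx_J opprK.
- by exists r => s /rW; rewrite QE wronskian_Kmx mxrank_opp.
exists r' => s scd; rewrite -(rX s scd) -mulmxA QE -[in RHS]mulmxA mulmxA.
by rewrite /Kmx mul_row_block !(mulmx0, mul0mx, mulmx1, addr0).
Qed.

(** The sign comes from the opposite order of the endpoints in the dual sum. *)
Lemma osc_sum_Kmx (R : realType) (n : nat) (Y : R -> 'M[R]_(n + n, n)) p t Q :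
  osc_sum (fun s => Kmx R n *m Y s) p t
    (fun k s => Kmx R n *m Q k s *m - Kmx R n) = - osc_sum_dual Y p t Q.
Proof.
rewrite /osc_sum /osc_sum_dual -sumrN; apply: eq_bigr => k _.
by rewrite -!mulmxA Kmx_E !mu_Kmx opprB.
Qed.

Lemma osc_admissible (R : realType) (n : nat) (a b : R)
    (Y : R -> 'M[R]_(n + n, n)) : a <= b -> lagrangian_path a b Y ->
  exists p t Q, admissible Y a b p t Q /\ osc Y a b = osc_sum Y p t Q.
Proof.
move=> ab /(osc_data_ex ab)[_ [p [t [Q adm]]]].
(* Existence of data makes [xget] return a genuine sum. Which one does not matter, since
   [osc_sum_diff] holds for all data. *)
apply: (@xgetPex _ 0 [set N : int | exists p t Q,
  admissible Y a b p t Q /\ N = osc_sum Y p t Q]).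
by exists (osc_sum Y p t Q), p, t, Q.
Qed.

Lemma osc_dual_admissible (R : realType) (n : nat) (a b : R)
    (Y : R -> 'M[R]_(n + n, n)) : a <= b -> lagrangian_path a b Y ->
  exists p t Q, admissible Y a b p t Q /\ osc_dual Y a b = osc_sum_dual Y p t Q.
Proof.
move=> ab /(osc_data_ex ab)[_ [p [t [Q adm]]]].
apply: (@xgetPex _ 0 [set N : int | exists p t Q,
  admissible Y a b p t Q /\ N = osc_sum_dual Y p t Q]).
by exists (osc_sum_dual Y p t Q), p, t, Q.
Qed.

Theorem theorem5p6 (R : realType) (n : nat) (a b : R) (leab : a <= b)
  (Phi : R -> 'M[R]_(n + n))
  (contPhi : {within `[a, b], continuous Phi})
  (sympPhi : forall t, t \in `[a, b] -> symplectic (Phi t))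
  (Y Yh : R -> 'M[R]_(n + n, n))
  (pathY : lagrangian_path a b Y) (pathYh : lagrangian_path a b Yh)
  (FY : Lfamily a b Phi Y) (FYh : Lfamily a b Phi Yh) :
  osc Y a b - osc Yh a b
    = (mu (Y b) (Yh b))%:Z - (mu (Y a) (Yh a))%:Z
  /\
  osc_dual Y a b - osc_dual Yh a b
    = (mu_dual (Y a) (Yh a))%:Z - (mu_dual (Y b) (Yh b))%:Z.
Proof.
have [C [_ YC]] := FY; have [D [_ YhD]] := FYh.
(* Symplectic [Phi] preserves Wronskians, so this one does not depend on [s]. *)
have WE s : s \in `[a, b] -> wronskian (Y s) (Yh s) = wronskian C D.
  by move=> sab; rewrite YC // YhD // wronskian_symplectic //; exact: sympPhi.
split.
  have [p [t [Q [adm ->]]]] := osc_admissible leab pathY.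
  have [p' [t' [Q' [adm' ->]]]] := osc_admissible leab pathYh.
  apply: (osc_sum_diff (r := \rank (wronskian C D))) adm adm' => //.
  by move=> s /WE ->.
have [p [t [Q [adm ->]]]] := osc_dual_admissible leab pathY.
have [p' [t' [Q' [adm' ->]]]] := osc_dual_admissible leab pathYh.
(* The dual sums are, up to sign, ordinary sums for the image paths under [Kmx R n], whose Wronskian
   only changes sign. *)
have rW s : s \in `[a, b] ->
    \rank (wronskian (Kmx R n *m Y s) (Kmx R n *m Yh s)) = \rank (wronskian C
      D).
  by move=> /WE sW; rewrite wronskian_Kmx mxrank_opp sW.
have := osc_sum_diff leab (lagrangian_path_Kmx pathY) (lagrangian_path_Kmx
  pathYh)
  rW (admissible_Kmx adm) (admissible_Kmx adm').
by rewrite !osc_sum_Kmx !mu_Kmx; lia.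
Qed.
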